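(* Consider the constrained convex problem and the parallel random minibatch subgradient algorithm described in the context, under Assumption A (a), (b), (c) and Assumption B stated there. Let the stepsizes be $\alpha_k=\frac{4}{\mu(k+1)}$ for $k\ge 0$ and $\beta\in(0,2/L_N)$, with $L_N\le 1$ as defined in the context, and assume $cM_g^2L_N>1$. Then $q_N:=\frac{\beta(2-\beta L_N)}{cM_g^2}<1$, and, with $b_N^p:=(1-q_N)^{-1}-1$, the averaged sequence $$\hat x_t=\sum_{k=1}^t\frac{(k+1)^2}{S_t}\,x_k,\qquad S_t=\sum_{k=1}^t(k+1)^2,\qquad t\ge 1,$$ generated by the algorithm satisfies $$\mathsf{E}\big[|f(\hat x_t)-f^*|\big]\le \mathcal{O}\left(\frac1t+\frac{1}{\sqrt{b_N^p}\,t}\right),\qquad \mathsf{E}\big[\mathrm{dist}(\hat x_t,X)\big]\le\mathcal{O}\left(\frac{1}{\sqrt{b_N^p}\,t}\right),$$ where, for functions of $t$, $h_1(t)\le\mathcal{O}(h_2(t))$ means that there exist $C>0$ and $t_0$ such that $h_1(t)\le C\,h_2(t)$ for all $t\ge t_0$.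
   Context: Notation: $\|\cdot\|$ is the Euclidean norm on $\mathbb{R}^n$, $a^+=\max\{a,0\}$, $\Pi_Z$ is the Euclidean projection onto a closed convex set $Z$, $\mathrm{dist}(x,Z)=\min_{z\in Z}\|x-z\|$, $\partial h(x)$ is the subdifferential of a convex function $h$ at $x$, $s_f(x)$ denotes a subgradient of $f$ at $x$, and $g_\omega^+(x)=\max\{g_\omega(x),0\}$. Problem: minimize $f(x)$ subject to $x\in X:=Y\cap\left(\bigcap_{\omega\in\mathcal{A}}X_\omega\right)$, where $X_\omega=\{x\in\mathbb{R}^n: g_\omega(x)\le 0\}$ and $\mathcal{A}$ is an arbitrary (possibly infinite) index set. The functions $f$ and $g_\omega$ are convex with values in the extended reals, and their domains contain $Y$. The optimal value $f^*=\inf_{x\in X}f(x)$ is finite, and $X^*=\{x\in X: f(x)=f^*\}$. Assumption A. (a) $Y$ is closed and convex; $X$ and $X^*$ are nonempty. (b) $f$ is strongly convex on $Y$ with constant $\mu>0$: $f(y)\ge f(x)+\langle s,y-x\rangle+\frac{\mu}{2}\|y-x\|^2$ for all $x,y\in Y$ and $s\in\partial f(x)$; and there is $M_f>0$ with $\|s\|\le M_f$ for all $s\in\partial f(x)$, $x\in Y$. (c) There is $M_g>0$ such that $\|d\|\le M_g$ for all $d\in\partial g_\omega(x)$, $x\in Y$, $\omega\in\mathcal{A}$. Parallel algorithm: $x_0\in Y$ is random with an arbitrary distribution, $N\ge1$ is the minibatch size, $\alpha_k>0$ and $\beta>0$ are deterministic stepsizes. For $k\ge1$, draw random indices $\omega_k^1,\dots,\omega_k^N\in\mathcal{A}$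 according to a probability distribution $\mathbf{P}$ and set $$v_k=\Pi_Y[x_{k-1}-\alpha_{k-1}s_f(x_{k-1})],$$ $$z_k^i=v_k-\beta\,\frac{g^+_{\omega_k^i}(v_k)}{\|d_k^i\|^2}\,d_k^i\quad(i=1,\dots,N),\qquad \bar z_k=\frac1N\sum_{i=1}^N z_k^i,\qquad x_k=\Pi_Y[\bar z_k],$$ where $d_k^i\in\partial g^+_{\omega_k^i}(v_k)$ if $g^+_{\omega_k^i}(v_k)>0$, and $d_k^i=d$ for some arbitrary $d\neq0$ if $g^+_{\omega_k^i}(v_k)=0$. $\mathcal{F}_k$ denotes the sigma-field generated by $x_0$ and $\{\omega_t^j: 1\le t\le k,\ 1\le j\le N\}$; $\mathcal{F}_0$ is generated by $x_0$. Assumption B. There is a constant $c\in(0,\infty)$ such that $\mathrm{dist}^2(y,X)\le c\,\mathsf{E}\big[(g^+_{\omega_k^i}(y))^2\mid\mathcal{F}_{k-1}\big]$ for all $y\in Y$, $k\ge1$, $i=1,\dots,N$. (The indices $\omega_k^1,\dots,\omega_k^N$ need not be conditionally independent given $\mathcal{F}_{k-1}$.) Parameter $L_N$: for the iterates of the algorithm let $$L_N^k=\left\|\frac1N\sum_{i=1}^N\frac{g^+_{\omega_k^i}(v_k)}{\|d_k^i\|^2}d_k^i\right\|^2\Big/\ \frac1N\sum_{i=1}^N\frac{(g^+_{\omega_k^i}(v_k))^2}{\|d_k^i\|^2}$$ whenever the denominator is nonzero (by Jensen's inequality $L_N^k\le1$). $L_N$ is the maximum (supremum) of $L_N^k$ over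 all iterations $k$ and all realizations for which the denominator is nonzero; it is a deterministic constant in $(0,1]$ with $L_N^k\le L_N$ always. *)

(* Defs.v *)
(* Points of R^n are row vectors over an arbitrary [R : realType]. *)
From HB Require Import structures.
From mathcomp Require Import all_boot all_order all_algebra.
From mathcomp Require Import all_classical all_reals all_analysis.
From mathcomp Require Import measurable_realfun.

Set Implicit Arguments.
Unset Strict Implicit.
Unset Printing Implicit Defensive.

Import Order.TTheory GRing.Theory Num.Theory.
Import numFieldNormedType.Exports.

Local Open Scope classical_set_scope.
Local Open Scope ring_scope.

Section Euclidean.
Context {R : realType} {n : nat}.
Implicit Types (x y s : 'rV[R]_n) (Z : set 'rV[R]_n) (h : 'rV[R]_n -> \bar R).

Definition dot x y : R := \sum_(i < n) x 0 i * y 0 i.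

(* The library norm on ['rV[R]_n] is the sup norm, hence a separate Euclidean
   norm; both norms induce the same topology. *)
Definition enorm x : R := Num.sqrt (dot x x).

Definition dist x Z : R := inf [set enorm (x - z) | z in Z].

Definition proj Z x : 'rV[R]_n :=
  xget 0 [set p | Z p /\ forall z, Z z -> enorm (x - p) <= enorm (x - z)].

(* Convexity of an extended-real-valued function is convexity of its epigraph,
   which avoids the undefined sums +oo - oo. *)
Definition epigraph h : set ('rV[R]_n * R^o)%type :=
  [set p | (h p.1 <= (p.2 : R)%:E)%E].

Definition convex_efun h : Prop := convex_set (epigraph h).

Definition dom h : set 'rV[R]_n := [set x | (h x < +oo)%E].

Definition subdiff h x : set 'rV[R]_n :=
  [set s | forall y, (h x + (dot s (y - x))%:E <= h y)%E].

Definition borel_rV : set (set 'rV[R]_n) := <<s @open 'rV[R]_n >>.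

End Euclidean.

Section ConditionalExpectation.
Context {d : measure_display} {Omega : measurableType d} {R : realType}.

(* [Z] is a version of E[X | F], for [X] a nonnegative random variable and [F]
   a sub-sigma-field. *)
Definition is_cond_expectation (P : probability Omega R)
    (F : set (set Omega)) (X Z : Omega -> \bar R) : Prop :=
  [/\ forall w, (0 <= Z w)%E,
      forall B, measurable B -> F (Z @^-1` B) &
      forall A, F A -> (\int[P]_(w in A) Z w = \int[P]_(w in A) X w)%E].

End ConditionalExpectation.

Section Problem.
Context {R : realType} {n : nat} {dA : measure_display}.
Context {A : measurableType dA}.
Variables (f : 'rV[R]_n -> \bar R) (g : A -> 'rV[R]_n -> \bar R).
Variable Y : set 'rV[R]_n.

Definition feasible : set 'rV[R]_n :=
  Y `&` \bigcap_a [set x | (g a x <= 0)%E].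

Definition optimal_value : \bar R := ereal_inf (f @` feasible).

Definition optimal_set : set 'rV[R]_n :=
  [set x | feasible x /\ f x = optimal_value].

(* The index set carries a sigma-field because indices are sampled from it;
   [measurable_g] is what makes g_omega(y) a random variable. *)
Record convex_problem : Prop := ConvexProblem {
  convex_f : convex_efun f ;
  convex_g : forall a, convex_efun (g a) ;
  dom_f : Y `<=` dom f ;
  dom_g : forall a, Y `<=` dom (g a) ;
  measurable_g : forall y, Y y -> measurable_fun [set: A] (fun a => g a y) ;
  optimal_value_fin : optimal_value \is a fin_num }.

Record assumption_A (mu Mf Mg : R) : Prop := AssumptionA {
  Y_closed : closed Y ;
  Y_convex : convex_set Y ;
  feasible_nonempty : feasible !=set0 ;
  optimal_nonempty : optimal_set !=set0 ;
  mu_gt0 : 0 < mu ;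
  strongly_convex : forall x y s, Y x -> Y y -> subdiff f x s ->
    (f x + (dot s (y - x) + mu / 2 * enorm (y - x) ^+ 2)%:E <= f y)%E ;
  Mf_gt0 : 0 < Mf ;
  subgradient_f_bounded : forall x s, Y x -> subdiff f x s -> enorm s <= Mf ;
  Mg_gt0 : 0 < Mg ;
  subgradient_g_bounded : forall a x s,
    Y x -> subdiff (g a) x s -> enorm s <= Mg }.

End Problem.

Section Algorithm.
Context {R : realType} {n N : nat}.
Context {dA : measure_display} {A : measurableType dA}.
Context {dO : measure_display} {Omega : measurableType dO}.
Variables (f : 'rV[R]_n -> \bar R) (g : A -> 'rV[R]_n -> \bar R).
Variable Y : set 'rV[R]_n.
Variable Pr : probability Omega R.
(* [om k i] is meaningful for k >= 1 only, and so are [v k] and [d k i]. *)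
Variable om : nat -> 'I_N -> {RV Pr >-> A}.
Variables x v : nat -> Omega -> 'rV[R]_n.
Variable d : nat -> 'I_N -> Omega -> 'rV[R]_n.

(* The sigma-field generated by x_0 and the indices of iterations 1, ..., k. *)
Definition history (k : nat) : set (set Omega) :=
  <<s preimage_set_system setT (x 0%N) borel_rV `|`
      \bigcup_(t in [set t | (0 < t <= k)%N]) \bigcup_(j : 'I_N)
        preimage_set_system setT (om t j) measurable >>.

Definition vector_measurable (F : set (set Omega)) (X : Omega -> 'rV[R]_n) :=
  forall B, borel_rV B -> F (X @^-1` B).

(* g^+ for the sampled constraint (i, k) at v_k; a real number, because [g a]
   is < +oo on [Y]. *)
Definition violation (k : nat) (i : 'I_N) (w : Omega) : R :=
  fine ((g (om k i w))^\+%E (v k w)).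

Definition z (beta : R) (k : nat) (i : 'I_N) (w : Omega) : 'rV[R]_n :=
  v k w - (beta * (violation k i w / enorm (d k i w) ^+ 2)) *: d k i w.

Definition zbar (beta : R) (k : nat) (w : Omega) : 'rV[R]_n :=
  N%:R^-1 *: \sum_(i < N) z beta k i w.

(* [sf] picks a subgradient of f at every point of Y, and [subgradients_exist]
   says that a subgradient step is available wherever a constraint is violated:
   the method can be run from any point of Y.  The selections [sf] and [d] are
   otherwise arbitrary, except that the iterates they produce are determined
   measurably by x_0 and the indices ([v_adapted] and [x_adapted]). *)
Record parallel_algorithm (PA : probability A R) (alpha : nat -> R) (beta : R)
    (sf : 'rV[R]_n -> 'rV[R]_n) : Prop := ParallelAlgorithm {
  x0_random : vector_measurable measurable (x 0%N) ;
  x0_in_Y : forall w, Y (x 0%N w) ;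
  index_law : forall k i, (0 < k)%N ->
    forall B, measurable B -> distribution Pr (om k i) B = PA B ;
  sf_subgradient : forall y, Y y -> subdiff f y (sf y) ;
  subgradients_exist : forall a y, Y y -> (0 < (g a)^\+ y)%E ->
    subdiff (g a)^\+%E y !=set0 ;
  v_step : forall k w,
    v k.+1 w = proj Y (x k w - alpha k *: sf (x k w)) ;
  d_violated : forall k i w, (0 < (g (om k.+1 i w))^\+ (v k.+1 w))%E ->
    subdiff (g (om k.+1 i w))^\+%E (v k.+1 w) (d k.+1 i w) ;
  d_satisfied : forall k i w, (g (om k.+1 i w))^\+%E (v k.+1 w) = 0%E ->
    d k.+1 i w != 0 ;
  x_step : forall k w, x k.+1 w = proj Y (zbar beta k.+1 w) ;
  v_adapted : forall k, vector_measurable (history k) (v k.+1) ;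
  x_adapted : forall k, vector_measurable (history k) (x k) }.

Definition assumption_B (c : R) : Prop :=
  forall y (k : nat) (i : 'I_N), Y y -> (0 < k)%N ->
  exists Z : Omega -> \bar R,
    is_cond_expectation Pr (history k.-1)
      (fun w => ((g (om k i w))^\+ y ^+ 2)%E) Z /\
    {ae Pr, forall w,
      ((dist y (feasible g Y) ^+ 2)%:E <= c%:E * Z w)%E}.

Definition ratio_num (k : nat) (w : Omega) : R :=
  enorm (N%:R^-1 *: \sum_(i < N)
    ((violation k i w / enorm (d k i w) ^+ 2) *: d k i w)) ^+ 2.

Definition ratio_den (k : nat) (w : Omega) : R :=
  N%:R^-1 * \sum_(i < N) (violation k i w ^+ 2 / enorm (d k i w) ^+ 2).

Definition minibatch_ratios : set R :=
  [set r | exists k w, [/\ (0 < k)%N, ratio_den k w != 0 &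
                           r = ratio_num k w / ratio_den k w]].

(* When no ratio is defined (no constraint is ever violated) the supremum is
   meaningless, and any constant in (0, 1] is accepted. *)
Definition is_minibatch_constant (L : R) : Prop :=
  0 < L <= 1 /\ (minibatch_ratios !=set0 -> L = sup minibatch_ratios).

Definition weight_sum (t : nat) : R := \sum_(1 <= k < t.+1) k.+1%:R ^+ 2.

Definition average (t : nat) (w : Omega) : 'rV[R]_n :=
  \sum_(1 <= k < t.+1) (k.+1%:R ^+ 2 / weight_sum t) *: x k w.

End Algorithm.

Definition le_bigO {R : realType} (h1 : nat -> \bar R) (h2 : nat -> R) : Prop :=
  exists (C : R) (t0 : nat), 0 < C /\
    forall t, (t0 <= t)%N -> (h1 t <= (C * h2 t)%:E)%E.

(* Main.v *)
Require Import Defs.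
From HB Require Import structures.
From mathcomp Require Import all_boot all_order all_algebra.
From mathcomp Require Import all_classical all_reals all_analysis.
From mathcomp Require Import measurable_realfun.
From mathcomp Require Import ring lra.
Set Implicit Arguments.
Unset Strict Implicit.
Unset Printing Implicit Defensive.

Import Order.TTheory GRing.Theory Num.Theory.
Import numFieldNormedType.Exports.
Local Open Scope classical_set_scope.
Local Open Scope ring_scope.

(** Strong convexity together with bounded subgradients forces Y to be bounded,
    so all the random variables involved are bounded.  One iteration gives,
    pathwise and for x* optimal,
      |x_(k+1) - x*|^2 <= (1 - alpha_k mu) |x_k - x*|^2
        - 2 alpha_k (f x_k - f* ) + (alpha_k Mf)^2 - kappa mean_i (g_i^+ v_(k+1))^2
    with kappa = beta (2 - beta L) / Mg^2, and Assumption B, applied at the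
    random point v_(k+1), turns the last term into q dist(v_(k+1), X)^2 in
    expectation.  Multiplying by (k+1)^3 makes the inequality telescope because
    (k-3)(k+1)^2 <= k^3.  The possibly negative gap f x_k - f* is bounded below
    by - Mf dist(x_k, X), which the quadratic distance term absorbs, so that
    sum_k (k+1)^3 E dist^2, sum_k (k+1)^2 E dist and sum_k (k+1)^2 E gap are all
    O(t^2), against a normalisation S_t >= t^3 / 3. *)

(** * Euclidean inner product, norm and weighted means of row vectors *)

Section EuclideanGeometry.
Context {R : realType} {n : nat}.
Implicit Types (x y z p : 'rV[R]_n) (Z : set 'rV[R]_n).

Lemma dotC x y : dot x y = dot y x.
Proof. by apply: eq_bigr => i _; rewrite mulrC. Qed.

Lemma dotDl x y z : dot (x + y) z = dot x z + dot y z.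
Proof. by rewrite -big_split; apply: eq_bigr => i _; rewrite mxE mulrDl. Qed.

Lemma dotZl a x y : dot (a *: x) y = a * dot x y.
Proof. by rewrite /dot mulr_sumr; apply: eq_bigr => i _; rewrite mxE mulrA. Qed.

Lemma dotDr x y z : dot z (x + y) = dot z x + dot z y.
Proof. by rewrite !(dotC z) dotDl. Qed.

Lemma dotZr a x y : dot x (a *: y) = a * dot x y.
Proof. by rewrite !(dotC x) dotZl. Qed.

Lemma dotNl x y : dot (- x) y = - dot x y.
Proof. by rewrite -scaleN1r dotZl mulN1r. Qed.

Lemma dotNr x y : dot x (- y) = - dot x y.
Proof. by rewrite !(dotC x) dotNl. Qed.

Definition dotE := (dotDl, dotDr, dotNl, dotNr, dotZl, dotZr).

Lemma dot_subZ x y a :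
  dot (x - a *: y) (x - a *: y) = dot x x - 2 * a * dot x y + a ^+ 2 * dot y y.
Proof. by rewrite !dotE (dotC y x); ring. Qed.

Lemma dot0l x : dot 0 x = 0.
Proof. by rewrite -(scale0r 0) dotZl mul0r. Qed.

Lemma dot0r x : dot x 0 = 0.
Proof. by rewrite dotC dot0l. Qed.

Lemma dot_suml I (r : seq I) (P : pred I) (F : I -> 'rV[R]_n) y :
  dot (\sum_(i <- r | P i) F i) y = \sum_(i <- r | P i) dot (F i) y.
Proof.
apply: (big_morph (fun x => dot x y)); last exact: dot0l.
by move=> a b; rewrite dotDl.
Qed.

Lemma dotxx_ge0 x : 0 <= dot x x.
Proof. by apply: sumr_ge0 => i _; rewrite -expr2 sqr_ge0. Qed.

Lemma dotxx_eq0 x : dot x x = 0 -> x = 0.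
Proof.
move=> /eqP; rewrite psumr_eq0 => [/allP x0|i _]; last by rewrite -expr2 sqr_ge0.
apply/rowP => i; have /implyP/(_ isT) := x0 i (mem_index_enum i).
by rewrite -expr2 sqrf_eq0 mxE => /eqP.
Qed.

Lemma enorm_ge0 x : 0 <= enorm x.
Proof. exact: sqrtr_ge0. Qed.
Hint Resolve enorm_ge0 : core.

Lemma enorm_sqr x : enorm x ^+ 2 = dot x x.
Proof. by rewrite sqr_sqrtr// dotxx_ge0. Qed.

Lemma enorm0 : enorm (0 : 'rV[R]_n) = 0.
Proof. by rewrite /enorm dot0l sqrtr0. Qed.

Lemma enorm_eq0 x : enorm x = 0 -> x = 0.
Proof. by move=> x0; apply: dotxx_eq0; rewrite -enorm_sqr x0 expr0n. Qed.

Lemma enormN x : enorm (- x) = enorm x.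
Proof. by rewrite /enorm dotNl dotNr opprK. Qed.

Lemma enormB x y : enorm (x - y) = enorm (y - x).
Proof. by rewrite -enormN opprB. Qed.

Lemma enormZ a x : enorm (a *: x) = `|a| * enorm x.
Proof.
by rewrite /enorm dotZl dotZr mulrA -expr2 sqrtrM ?sqr_ge0// sqrtr_sqr.
Qed.

(** For [y] nonzero, expand the nonnegative square of [dot y y *: x - dot x y *: y] and cancel one
    factor [dot y y]. *)
Lemma cauchy_schwarz x y : dot x y <= enorm x * enorm y.
Proof.
have [y0|y0] := eqVneq (dot y y) 0.
  by rewrite (dotxx_eq0 y0) dot0r enorm0 mulr0.
have yy : 0 < dot y y by rewrite lt_neqAle eq_sym y0 dotxx_ge0.
have h : dot x y ^+ 2 <= dot x x * dot y y.
  have := dotxx_ge0 (dot y y *: x - dot x y *: y).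
  rewrite !dotE (dotC y x) => h.
  rewrite -(ler_pM2l yy); lra.
rewrite (le_trans (ler_norm _))// -(@ler_pXn2r _ 2) ?nnegrE ?mulr_ge0//.
by rewrite exprMn !enorm_sqr -normrX ger0_norm ?sqr_ge0.
Qed.

Lemma ler_enormD x y : enorm (x + y) <= enorm x + enorm y.
Proof.
rewrite -(@ler_pXn2r _ 2) ?nnegrE ?addr_ge0//.
rewrite sqrrD !enorm_sqr !dotE (dotC y x).
have := cauchy_schwarz x y; lra.
Qed.

Lemma enorm_triangle z x y : enorm (x - y) <= enorm (x - z) + enorm (z - y).
Proof. by apply: le_trans (ler_enormD _ _); rewrite addrA subrK. Qed.

Lemma enorm_sum I (r : seq I) (P : pred I) (F : I -> 'rV[R]_n) :
  enorm (\sum_(i <- r | P i) F i) <= \sum_(i <- r | P i) enorm (F i).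
Proof.
elim/big_ind2 : _ => //; first by rewrite enorm0.
by move=> x a y b xa yb; apply: le_trans (ler_enormD _ _) _; exact: lerD.
Qed.

Lemma coord_le_mx_norm x i : `|x 0 i| <= `|x|.
Proof.
rewrite [leRHS]/Num.norm /= mx_normrE.
by apply/bigmax_geP; right => /=; exists (0, i).
Qed.

(** Bridge to the topology carried by the sup norm: this bound makes [enorm] continuous and its
    balls open, while the reverse bound [mx_norm_le_enorm] turns a Euclidean diameter into
    boundedness for [compact_Y]. *)
Lemma enorm_le_mx_norm x : enorm x <= Num.sqrt n%:R * `|x|.
Proof.
rewrite -(@ler_pXn2r _ 2) ?nnegrE ?mulr_ge0 ?sqrtr_ge0//.
rewrite exprMn enorm_sqr sqr_sqrtr//.
apply: (@le_trans _ _ (\sum_(i < n) `|x| ^+ 2)).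
  apply: ler_sum => i _; rewrite -expr2 -[leLHS]ger0_norm ?sqr_ge0// normrX.
  by rewrite lerXn2r ?nnegrE// coord_le_mx_norm.
by rewrite sumr_const card_ord mulr_natl.
Qed.

Lemma mx_norm_le_enorm x : `|x| <= enorm x.
Proof.
rewrite [leLHS]/Num.norm /= mx_normrE; apply/bigmax_leP; split => // -[i j] _ /=.
rewrite ord1 -(@ler_pXn2r _ 2) ?nnegrE// enorm_sqr -normrX ger0_norm ?sqr_ge0//.
rewrite /dot (bigD1 j)//= -expr2 lerDl.
by apply: sumr_ge0 => k _; rewrite -expr2 sqr_ge0.
Qed.

Lemma enorm_continuous : continuous (@enorm R n).
Proof.
move=> x; apply/(@cvgrPdist_lt _ _ _ _ (nbhs_filter x)) => e e0.
have k0 : 0 < Num.sqrt n%:R + 1 :> R by rewrite ltr_pwDr// sqrtr_ge0.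
apply/nbhs_ballP; exists (e / (Num.sqrt n%:R + 1)) => /=; first exact: divr_gt0.
move=> y; rewrite -ball_normE /= => xy.
have xye : enorm (x - y) < e.
  apply: le_lt_trans (enorm_le_mx_norm _) _.
  rewrite ltr_pdivlMr// in xy; apply: le_lt_trans xy.
  by rewrite mulrC ler_wpM2l// lerDl.
apply: le_lt_trans xye; rewrite ler_norml.
have := enorm_triangle y x 0; have := enorm_triangle x y 0.
rewrite !subr0 (enormB y x); lra.
Qed.

Lemma enormB_continuous z : continuous (fun y => enorm (z - y)).
Proof.
move=> y; apply: (@continuous_comp _ _ _ (fun y => z - y) (@enorm R n)).
  by apply: continuousB; [exact: cst_continuous|].
exact: enorm_continuous.
Qed.

Lemma open_enorm_lt z r : open [set y | enorm (z - y) < r].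
Proof.
rewrite (_ : [set y | _] = (fun y => enorm (z - y)) @^-1` [set a | a < r])//.
by apply: open_comp (@open_lt _ r) => y _; exact: enormB_continuous.
Qed.

Lemma convex_set_conv Z x y (t : R) : convex_set Z ->
  0 <= t <= 1 -> Z x -> Z y -> Z (t *: x + (1 - t) *: y).
Proof.
move=> cZ /andP[t0 t1] Zx Zy.
by have := cZ x y (Itv01 t0 t1) (mem_set Zx) (mem_set Zy); rewrite inE.
Qed.

(** Induction on [t]: with [s] the previous total weight, the new mean is the convex combination of
    the old mean and the last point with coefficient [s / (s + p t.+2)]. *)
Lemma convex_weighted_mean Z (p : nat -> R) (u : nat -> 'rV[R]_n) t :
  convex_set Z -> (0 < t)%N -> (forall k, 0 < p k) ->
  (forall k, (0 < k)%N -> Z (u k)) ->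
  Z (\sum_(1 <= k < t.+1) (p k / \sum_(1 <= j < t.+1) p j) *: u k).
Proof.
move=> cZ + p0 Zu; case: t => // t _; elim: t => [|t IH].
  by rewrite !big_nat1 divff ?gt_eqF// scale1r; exact: Zu.
set s := \sum_(1 <= j < t.+2) p j in IH *.
have s0 : 0 < s.
  by rewrite /s big_ltn// ltr_pwDl// sumr_ge0// => i _; exact: ltW.
rewrite (@big_nat_recr _ _ _ t.+2)//= (@big_nat_recr _ _ _ t.+2)//= -/s.
have sp0 : 0 < s + p t.+2 by rewrite addr_gt0.
have -> : p t.+2 / (s + p t.+2) = 1 - s / (s + p t.+2).
  by field; rewrite gt_eqF.
rewrite (eq_bigr (fun k => (s / (s + p t.+2)) *: ((p k / s) *: u k))); last first.
  by move=> k _; rewrite scalerA; congr (_ *: _); field; rewrite !gt_eqF.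
rewrite -scaler_sumr; apply: convex_set_conv => //; last exact: Zu.
by rewrite divr_ge0 ?(ltW s0) ?(ltW sp0)//= ler_pdivrMr// mul1r lerDl ltW.
Qed.

End EuclideanGeometry.
#[local] Hint Extern 0 (is_true (0 <= enorm _)) => exact: enorm_ge0 : core.

(** * Distance to a nonempty set *)

Section Distance.
Context {R : realType} {n : nat}.
Variable Z : set 'rV[R]_n.
Hypothesis Z0 : Z !=set0.
Implicit Types (x y z : 'rV[R]_n).

Lemma dist_has_lbound x : has_lbound [set enorm (x - z) | z in Z].
Proof. by exists 0 => _ [z _ <-]. Qed.

Lemma dist_ge0 x : 0 <= dist x Z.
Proof.
apply: lb_le_inf; last by move=> _ [z _ <-].
by have [z Zz] := Z0; exists (enorm (x - z)), z.
Qed.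

Lemma dist_le x z : Z z -> dist x Z <= enorm (x - z).
Proof. by move=> Zz; apply: (ge_inf (dist_has_lbound x)); exists z. Qed.

Lemma dist_approx x e : 0 < e -> exists2 z, Z z & enorm (x - z) < dist x Z + e.
Proof.
move=> e0; have hi : has_inf [set enorm (x - z) | z in Z].
  split; last exact: dist_has_lbound.
  by have [z Zz] := Z0; exists (enorm (x - z)), z.
by have [_ [z Zz <-] zx] := inf_adherent e0 hi; exists z.
Qed.

Lemma dist_lipschitz x y : dist x Z <= dist y Z + enorm (x - y).
Proof.
apply/ler_addgt0Pr => e e0; have [z Zz yz] := dist_approx y e0.
have := dist_le x Zz; have := enorm_triangle y x z; lra.
Qed.

(** Jensen's inequality for the distance: almost nearest points of the [u k] have their weighted
    mean in [Z], and the triangle inequality compares the two means up to [e]. *)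
Lemma dist_weighted_mean (p : nat -> R) (u : nat -> 'rV[R]_n) t :
  convex_set Z -> (0 < t)%N -> (forall k, 0 < p k) ->
  dist (\sum_(1 <= k < t.+1) (p k / \sum_(1 <= j < t.+1) p j) *: u k) Z <=
  \sum_(1 <= k < t.+1) (p k / \sum_(1 <= j < t.+1) p j) * dist (u k) Z.
Proof.
move=> cZ t0 p0; set s := \sum_(1 <= j < t.+1) p j.
have s0 : 0 < s.
  by rewrite /s big_ltn// ltr_pwDl// sumr_ge0// => i _; exact: ltW.
apply/ler_addgt0Pr => e e0.
have /choice[z zP] k : exists z, Z z /\ enorm (u k - z) < dist (u k) Z + e.
  by have [z Zz uz] := dist_approx (u k) e0; exists z.
have Zm := convex_weighted_mean cZ t0 p0 (fun k _ => (zP k).1).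
apply: le_trans (dist_le _ Zm) _; rewrite -/s -sumrB.
apply: le_trans (enorm_sum _ _ _) _.
have -> : e = \sum_(1 <= k < t.+1) (p k / s) * e.
  by rewrite -mulr_suml -mulr_suml divff ?mul1r// gt_eqF.
rewrite -big_split/=; apply: ler_sum => k _.
rewrite -scalerBr enormZ ger0_norm; last by rewrite divr_ge0// ltW.
rewrite -mulrDr ler_wpM2l//; first by rewrite divr_ge0// ltW.
exact/ltW/(zP k).2.
Qed.

End Distance.

(** * Projection onto a compact convex set *)

Section Projection.
Context {R : realType} {n : nat}.
Variable Y : set 'rV[R]_n.
Hypotheses (cY : compact Y) (convY : convex_set Y) (Y0 : Y !=set0).
Implicit Types (x y p : 'rV[R]_n).

(** The continuous function [enorm (x - y)] attains its minimum on the compact set [Y], so [xget]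
    never returns its default value. *)
Lemma projP x : Y (Defs.proj Y x) /\
  forall z, Y z -> enorm (x - Defs.proj Y x) <= enorm (x - z).
Proof.
rewrite /Defs.proj; set P := [set p | _].
have : P (xget 0 P); last by [].
apply: xgetPex.
have [|p] := @EVT_min_rV R n (fun y => enorm (x - y)) Y Y0 cY.
  by apply: continuous_subspaceT => y; exact: enormB_continuous.
by rewrite inE => Yp h; exists p; split=> // z Yz; apply: h; rewrite inE.
Qed.

Lemma proj_in x : Y (Defs.proj Y x). Proof. by have [] := projP x. Qed.

(** Moving from the projection [p] a fraction [t] towards [y] cannot reduce the distance to [x].
    After division by [t] the error is [t * D], and [t] is chosen to make it at most [e]; the [+ 1]
    in the denominator covers [D = 0]. *)
Lemma proj_variational x y : Y y -> dot (x - Defs.proj Y x) (y - Defs.proj Y x) <= 0.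
Proof.
move=> Yy; have [Yp hp] := projP x; set p := Defs.proj Y x in Yp hp *.
apply/ler_addgt0Pr => e e0; rewrite add0r.
set D := dot (y - p) (y - p).
have D0 : 0 <= D := dotxx_ge0 _.
pose t := Num.min 1 (e / (D + 1)).
have D1 : 0 < D + 1 by lra.
have t0 : 0 < t by rewrite lt_min ltr01 divr_gt0.
have t1 : t <= 1 by rewrite ge_min lexx.
have te : t * (D + 1) <= e by rewrite -ler_pdivlMr// ge_min lexx orbT.
have Yz : Y (t *: y + (1 - t) *: p) by apply: convex_set_conv => //; lra.
have := hp _ Yz; rewrite -(@ler_pXn2r _ 2) ?nnegrE// !enorm_sqr.
have -> : x - (t *: y + (1 - t) *: p) = (x - p) - t *: (y - p).
  by rewrite scalerBl scale1r scalerBr; apply/rowP => i; rewrite !mxE; ring.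
rewrite dot_subZ -/D => h.
have : t * (2 * dot (x - p) (y - p)) <= t * (t * D) by lra.
rewrite ler_pM2l// => h2.
have : t * D <= t * (D + 1) by rewrite ler_wpM2l ?lerDl// ltW.
lra.
Qed.

(** Expand the square of [(x - p) - (y - p)]: the cross term has the right sign by
    [proj_variational]. *)
Lemma enorm_proj_le x y : Y y -> enorm (Defs.proj Y x - y) <= enorm (x - y).
Proof.
move=> Yy; have := proj_variational x Yy; set p := Defs.proj Y x.
have -> : x - y = (x - p) - (y - p) by rewrite opprB addrA subrK.
rewrite -(enormN (p - y)) opprB => h.
rewrite -(@ler_pXn2r _ 2) ?nnegrE// !enorm_sqr.
rewrite -{3 4}(scale1r (y - p)) dot_subZ; have := dotxx_ge0 (x - p); lra.
Qed.

End Projection.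

(** * Subgradients of a convex function and of its positive part *)

Section Subgradients.
Context {R : realType} {n : nat}.
Implicit Types (x y s : 'rV[R]_n) (h : 'rV[R]_n -> \bar R).

Lemma convex_efun_le h x y (a b t : R) : convex_efun h -> 0 <= t <= 1 ->
  (h x <= a%:E)%E -> (h y <= b%:E)%E ->
  (h (t *: x + (1 - t) *: y)%R <= (t * a + (1 - t) * b)%R%:E)%E.
Proof.
move=> ch /andP[t0 t1] hx hy.
have := ch (x, a : R^o) (y, b : R^o) (Itv01 t0 t1).
by rewrite !inE /epigraph /=; exact.
Qed.

(* At a point where [h > 0], the segment towards [y] starts inside the region
   [h > 0], where [h] and its positive part coincide; convexity then carries
   the subgradient inequality over to [y] without any continuity. *)
Lemma subdiff_funepos h x s : convex_efun h -> (h x < +oo)%E ->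
  (0 < h^\+ x)%E -> subdiff h^\+%E x s -> subdiff h x s.
Proof.
move=> ch hx hx0 sx y.
have hx0' : (0 < h x)%E by move: hx0; rewrite funeposE lt_max ltxx orbF.
have [r hr] : exists r, h x = r%:E.
  by case: (h x) hx hx0' => // r _ _; exists r.
have r0 : 0 < r by rewrite -lte_fin -hr.
have hpr : (h^\+ x = r%:E)%E by rewrite funeposE hr max_l// lee_fin ltW.
rewrite hr -EFinD leNgt; apply/negP => hlt.
set c := dot s (y - x) in hlt.
(* A real upper bound [b] also covers [h y = -oo], where any number below [r + c] will do. *)
have [b hb bc] : exists2 b, (h y <= b%:E)%E & b < r + c.
  case hy: (h y) hlt => [b||]//; first by rewrite lte_fin; exists b.
  by move=> _; exists (r + c - 1); [exact: leNye|rewrite gtrBl].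
(* With [t = m / 2] the affine minorant [r + t * c] stays positive, so the positive part at the
   intermediate point can exceed it only through [h] itself. *)
set m := Num.min 1 (r / (`|c| + 1)).
have c0 : 0 <= `|c| by [].
have m0 : 0 < m by rewrite lt_min ltr01 divr_gt0// ltr_wpDl.
have m1 : m <= 1 by rewrite ge_min lexx.
have mr : m * (`|c| + 1) <= r.
  by rewrite -ler_pdivlMr ?ltr_wpDl// ge_min lexx orbT.
pose t := m / 2.
have t0 : 0 < t by rewrite divr_gt0.
have t1 : 0 <= t <= 1 by rewrite /t; lra.
have rtc : 0 < r + t * c.
  have tc : t * (`|c| + 1) <= r / 2 by rewrite /t; lra.
  have : - (t * `|c|) <= t * c.
    by rewrite -mulrN ler_pM2l// lerNl -normrN ler_norm.
  lra.
have hxle : (h x <= r%:E)%E by rewrite hr.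
have hz := convex_efun_le ch t1 hb hxle.
have := sx (t *: y + (1 - t) *: x); rewrite hpr.
have -> : t *: y + (1 - t) *: x - x = t *: (y - x).
  by apply/rowP => i; rewrite !mxE; ring.
rewrite dotZr -/c -EFinD funeposE le_max lee_fin [X in _ || X]leNgt rtc orbF.
move=> /le_trans/(_ hz); rewrite lee_fin => h1.
have : t * (r + c) <= t * b by lra.
by rewrite ler_pM2l// leNgt bc.
Qed.

End Subgradients.

(** * Consequences of Assumption A for the objective and the constraints *)

Section ConvexProblem.
Context {R : realType} {n : nat} {dA : measure_display} {A : measurableType dA}.
Variables (f : 'rV[R]_n -> \bar R) (g : A -> 'rV[R]_n -> \bar R).
Variables (Y : set 'rV[R]_n) (mu Mf Mg : R) (sf : 'rV[R]_n -> 'rV[R]_n).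
Hypothesis hproblem : convex_problem f g Y.
Hypothesis hA : assumption_A f g Y mu Mf Mg.
Hypothesis sfP : forall y, Y y -> subdiff f y (sf y).
Hypothesis subgP : forall a y, Y y -> (0 < (g a)^\+ y)%E ->
  subdiff (g a)^\+%E y !=set0.

Let X := feasible g Y.
Let fr y : R := fine (f y).
Let gp a y : R := fine ((g a)^\+%E y).
Let fstar : R := fine (optimal_value f g Y).

Lemma optimal_valueE : optimal_value f g Y = fstar%:E.
Proof. by rewrite /fstar fineK//; exact: optimal_value_fin hproblem. Qed.

(** The subgradient inequality at an optimal point, where [f] is finite, excludes [-oo]; [dom_f]
    excludes [+oo]. *)
Lemma f_fin y : Y y -> f y = (fr y)%:E.
Proof.
move=> Yy; rewrite /fr fineK// fin_numElt (dom_f hproblem Yy) andbT.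
have [xs [[Yxs _] fxs]] := optimal_nonempty hA.
have /(_ y) := sfP Yxs; rewrite fxs optimal_valueE -EFinD.
by apply: lt_le_trans; exact: ltNyr.
Qed.

Lemma f_strong y z : Y y -> Y z ->
  fr y + dot (sf y) (z - y) + mu / 2 * enorm (z - y) ^+ 2 <= fr z.
Proof.
move=> Yy Yz; have := strongly_convex hA Yy Yz (sfP Yy).
by rewrite !f_fin// -EFinD lee_fin addrA.
Qed.

Lemma f_subgrad y z : Y y -> Y z -> fr y + dot (sf y) (z - y) <= fr z.
Proof. by move=> Yy Yz; have := sfP Yy z; rewrite !f_fin// -EFinD lee_fin. Qed.

Lemma sf_le y : Y y -> enorm (sf y) <= Mf.
Proof. by move=> Yy; apply: (subgradient_f_bounded hA) (sfP Yy). Qed.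

Lemma f_lipschitz y z : Y y -> Y z -> fr y <= fr z + Mf * enorm (y - z).
Proof.
move=> Yy Yz; have := f_subgrad Yy Yz.
have : dot (sf y) (y - z) <= Mf * enorm (y - z).
  apply: le_trans (cauchy_schwarz _ _) _.
  by apply: ler_wpM2r => //; exact: sf_le.
rewrite -(opprB y z) dotNr; lra.
Qed.

(** With [r = enorm (y - z)], strong convexity gives growth [mu / 2 * r ^+ 2] beyond the linear
    term, while that term and the increase of [f] are each at most [Mf * r] in size. Hence
    [mu / 2 * r ^+ 2 <= 2 * Mf * r]. *)
Lemma Y_diameter y z : Y y -> Y z -> enorm (y - z) <= 4 * Mf / mu.
Proof.
move=> Yy Yz; have mu0 := mu_gt0 hA.
have := f_strong Yy Yz; have := f_lipschitz Yz Yy.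
have : dot (sf y) (y - z) <= Mf * enorm (y - z).
  apply: le_trans (cauchy_schwarz _ _) _.
  by apply: ler_wpM2r => //; exact: sf_le.
rewrite (enormB z y) -(opprB y z) dotNr => h1 h2 h3.
have [->|r0] := eqVneq (enorm (y - z)) 0.
  by rewrite divr_ge0 ?mulr_ge0// ltW// (Mf_gt0 hA).
have rp : 0 < enorm (y - z) by rewrite lt_neqAle eq_sym r0/=.
rewrite ler_pdivlMr// -(ler_pM2l rp); lra.
Qed.

Lemma compact_Y : compact Y.
Proof.
apply: bounded_closed_compact (Y_closed hA).
have [xs [[Yxs _] _]] := optimal_nonempty hA.
exists (`|xs| + 4 * Mf / mu); split => [|M MD y Yy]; first exact: num_real.
apply: le_trans (ltW MD); rewrite -(subrK xs y) addrC.
apply: le_trans (ler_normD _ _) _; rewrite lerD2l.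
by apply: le_trans (mx_norm_le_enorm _) _; exact: Y_diameter.
Qed.

Lemma g_pos_fin a y : Y y -> (g a)^\+%E y = (gp a y)%:E.
Proof.
move=> Yy; rewrite /gp fineK// ge0_fin_numE; last exact: funepos_ge0.
by rewrite funeposE gt_max ltry andbT; exact: (dom_g hproblem).
Qed.

Lemma gp_ge0 a y : 0 <= gp a y.
Proof. by apply: fine_ge0; exact: funepos_ge0. Qed.

Lemma gp_feasible a y : X y -> gp a y = 0.
Proof.
move=> [Yy /(_ a I)/= ga]; rewrite /gp funeposE.
by rewrite max_r.
Qed.

Lemma gp_subgrad a y z s : Y y -> subdiff (g a)^\+%E y s -> Y z ->
  gp a y + dot s (z - y) <= gp a z.
Proof. by move=> Yy /(_ z) + Yz; rewrite !g_pos_fin// -EFinD lee_fin. Qed.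

(** Where the constraint is violated, a subgradient of the positive part is one of [g a], to which
    the bound [Mg] applies. *)
Lemma gp_subgrad_le a y s : Y y -> 0 < gp a y -> subdiff (g a)^\+%E y s ->
  enorm s <= Mg.
Proof.
move=> Yy gy sy; apply: (subgradient_g_bounded hA Yy (a := a)).
apply: subdiff_funepos sy; first exact: (convex_g hproblem).
  exact: (dom_g hproblem).
by rewrite g_pos_fin// lte_fin.
Qed.

(** A zero subgradient would make [y] a minimizer of the positive part, which vanishes at a feasible
    point. This makes the division by [enorm (d k i w) ^+ 2] genuine at violated constraints. *)
Lemma gp_subgrad_neq0 a y s : Y y -> 0 < gp a y -> subdiff (g a)^\+%E y s ->
  s != 0.
Proof.
move=> Yy gy sy; have [xs [Xxs _]] := optimal_nonempty hA.
have Yxs : Y xs by case: Xxs.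
have := gp_subgrad Yy sy Yxs; rewrite (gp_feasible a Xxs).
by move=> h; apply/eqP => s0; move: h; rewrite s0 dot0l addr0 leNgt gy.
Qed.

(** At a violated [y] a subgradient exists by [subgP] and has norm at most [Mg]; otherwise the left
    side is zero. *)
Lemma gp_lipschitz a y z : Y y -> Y z ->
  gp a y <= gp a z + Mg * enorm (y - z).
Proof.
move=> Yy Yz; have [gy|gy] := ltP 0 (gp a y); last first.
  apply: le_trans gy _; rewrite addr_ge0 ?gp_ge0// mulr_ge0//.
  exact: ltW (Mg_gt0 hA).
have [|s sy] := subgP Yy (a := a); first by rewrite g_pos_fin// lte_fin.
have := gp_subgrad Yy sy Yz; have sM := gp_subgrad_le Yy gy sy.
have : dot s (y - z) <= Mg * enorm (y - z).
  by apply: le_trans (cauchy_schwarz _ _) _; exact: ler_wpM2r.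
rewrite -(opprB y z) dotNr; lra.
Qed.

Lemma convex_feasible : convex_set X.
Proof.
move=> x y t; rewrite !inE => -[Yx gx] [Yy gy]; split.
  have := Y_convex hA (x := x) (y := y) t.
  by rewrite !inE; exact.
move=> a _ /=.
have ca : convex_efun (g a) by exact: (convex_g hproblem).
have := convex_efun_le (t := t%:num) ca _ (gx a I) (gy a I).
rewrite !mulr0 addr0; apply.
by rewrite ge0 le1.
Qed.

(** Compare [y] with an almost nearest feasible point, whose value is at least [fstar]; the slack
    [e / Mf] becomes [e] after the Lipschitz bound. *)
Lemma f_ge_dist y : Y y -> fstar - Mf * dist y X <= fr y.
Proof.
move=> Yy; apply/ler_addgt0Pr => e e0; have Mf0 := Mf_gt0 hA.
have eM : 0 < e / Mf by exact: divr_gt0.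
have [z Xz yz] := dist_approx (feasible_nonempty hA) y eM.
have Yz : Y z by case: Xz.
have : fstar <= fr z.
  rewrite -lee_fin -optimal_valueE -f_fin//.
  by apply: ereal_inf_lbound; exists z.
have := f_lipschitz Yz Yy; rewrite (enormB z y).
have : Mf * enorm (y - z) <= Mf * (dist y X + e / Mf).
  by rewrite ler_pM2l// ltW.
have -> : Mf * (dist y X + e / Mf) = Mf * dist y X + e.
  by field; rewrite gt_eqF.
lra.
Qed.

(** Average the subgradient inequalities taken at the mean [m]: their linear terms cancel because
    the weighted deviations from [m] sum to zero. *)
Lemma f_weighted_mean (p : nat -> R) (u : nat -> 'rV[R]_n) t :
  (0 < t)%N -> (forall k, 0 < p k) -> (forall k, Y (u k)) ->
  fr (\sum_(1 <= k < t.+1) (p k / \sum_(1 <= j < t.+1) p j) *: u k) <=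
  \sum_(1 <= k < t.+1) (p k / \sum_(1 <= j < t.+1) p j) * fr (u k).
Proof.
move=> t0 p0 Yu; set s := \sum_(1 <= j < t.+1) p j.
have s0 : 0 < s.
  by rewrite /s big_ltn// ltr_pwDl// sumr_ge0// => i _; exact: ltW.
have Ym := convex_weighted_mean (Y_convex hA) t0 p0 (fun k _ => Yu k).
move: Ym; rewrite -/s; set m := \sum_(1 <= k < t.+1) _ => Ym.
have w1 : \sum_(1 <= k < t.+1) (p k / s) = 1.
  by rewrite -mulr_suml divff// gt_eqF.
have hm : \sum_(1 <= k < t.+1) (p k / s) *: (u k - m) = 0.
  under eq_bigr do rewrite scalerBr.
  by rewrite sumrB -scaler_suml w1 scale1r subrr.
have : \sum_(1 <= k < t.+1) (p k / s) * (fr m + dot (sf m) (u k - m)) <=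
  \sum_(1 <= k < t.+1) (p k / s) * fr (u k).
  apply: ler_sum => k _; rewrite ler_wpM2l ?f_subgrad//.
  by rewrite divr_ge0// ltW.
under eq_bigr do rewrite mulrDr -dotZr.
rewrite big_split/= -mulr_suml w1 mul1r.
suff -> : \sum_(1 <= k < t.+1) dot (sf m) ((p k / s) *: (u k - m)) = 0.
  by rewrite addr0.
by under eq_bigr do rewrite dotC; rewrite -dot_suml hm dot0l.
Qed.

End ConvexProblem.

(** * Pathwise inequalities for one iteration *)

Section Iterations.
Context {R : realType} {n N : nat}.
Context {dA : measure_display} {A : measurableType dA} (PA : probability A R).
Context {dO : measure_display} {Omega : measurableType dO}.
Variables (Pr : probability Omega R).
Variables (f : 'rV[R]_n -> \bar R) (g : A -> 'rV[R]_n -> \bar R).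
Variables (Y : set 'rV[R]_n) (mu Mf Mg beta LN : R) (alpha : nat -> R).
Variables (sf : 'rV[R]_n -> 'rV[R]_n) (om : nat -> 'I_N -> {RV Pr >-> A}).
Variables (x v : nat -> Omega -> 'rV[R]_n) (d : nat -> 'I_N -> Omega -> 'rV[R]_n).
Hypothesis hN : (1 <= N)%N.
Hypothesis hproblem : convex_problem f g Y.
Hypothesis hA : assumption_A f g Y mu Mf Mg.
Hypothesis halg : parallel_algorithm f g Y om x v d PA alpha beta sf.
Hypothesis alpha0 : forall k, 0 <= alpha k.
Hypothesis hLN : is_minibatch_constant g om v d LN.
Hypothesis hbeta : 0 < beta < 2 / LN.

Let X := feasible g Y.
Let fr y : R := fine (f y).
Let gp a y : R := fine ((g a)^\+%E y).
Let cY : compact Y := compact_Y hproblem hA (sf_subgradient halg).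
Let convY : convex_set Y := Y_convex hA.

Lemma Y_nonempty : Y !=set0.
Proof. by have [y [Yy _]] := feasible_nonempty hA; exists y. Qed.

Lemma x_in_Y k w : Y (x k w).
Proof.
case: k => [|k]; first exact: (x0_in_Y halg).
by rewrite (x_step halg); exact: (proj_in cY Y_nonempty).
Qed.

Lemma v_in_Y k w : Y (v k.+1 w).
Proof. by rewrite (v_step halg); exact: (proj_in cY Y_nonempty). Qed.

(** Projection does not increase the distance to [y]. In the expanded square, strong convexity at
    [x k w] bounds the cross term, which yields both the gap and the contraction factor. *)
Lemma gradient_step k w y : Y y ->
  enorm (v k.+1 w - y) ^+ 2 <= (1 - alpha k * mu) * enorm (x k w - y) ^+ 2
    - 2 * alpha k * (fr (x k w) - fr y) + (alpha k * Mf) ^+ 2.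
Proof.
move=> Yy; have Yx := x_in_Y k w; rewrite (v_step halg).
set xk := x k w in Yx *.
have := enorm_proj_le cY convY Y_nonempty (xk - alpha k *: sf xk) Yy.
set p := Defs.proj _ _.
rewrite -(@ler_pXn2r _ 2) ?nnegrE// => /le_trans; apply.
rewrite addrAC !enorm_sqr dot_subZ -!enorm_sqr.
have := f_strong hproblem hA (sf_subgradient halg) Yx Yy.
rewrite -(opprB xk y) enormN dotNr dotC -/fr => h.
have h1 : 2 * alpha k * (fr xk - dot (xk - y) (sf xk) +
    mu / 2 * enorm (xk - y) ^+ 2) <= 2 * alpha k * fr y.
  by rewrite ler_wpM2l// mulr_ge0.
have h2 : alpha k ^+ 2 * enorm (sf xk) ^+ 2 <= (alpha k * Mf) ^+ 2.
  rewrite exprMn ler_wpM2l ?sqr_ge0// lerXn2r ?nnegrE//.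
    exact: ltW (Mf_gt0 hA).
  exact: (sf_le hA (sf_subgradient halg)).
lra.
Qed.

Lemma gradient_step_length k w : enorm (v k.+1 w - x k w) <= alpha k * Mf.
Proof.
have Yx := x_in_Y k w; rewrite (v_step halg).
apply: le_trans (enorm_proj_le cY convY Y_nonempty _ Yx) _.
rewrite addrAC subrr sub0r enormN enormZ ger0_norm// ler_wpM2l//.
exact: (sf_le hA (sf_subgradient halg)).
Qed.

(** Turns the supremum defining [LN] into a product inequality that also holds for a zero
    denominator. *)
Lemma minibatch_ratio_le k w :
  ratio_num g om v d k.+1 w <= LN * ratio_den g om v d k.+1 w.
Proof.
have [/andP[L0 _] Lsup] := hLN.
have N0 : 0 < (N%:R^-1 : R) by rewrite invr_gt0 ltr0n.
have den_ge0 : 0 <= ratio_den g om v d k.+1 w.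
  rewrite mulr_ge0 ?(ltW N0)// sumr_ge0// => i _.
  by rewrite divr_ge0 ?sqr_ge0.
have [den0|den0] := eqVneq (ratio_den g om v d k.+1 w) 0; last first.
  have rM : minibatch_ratios g om v d
      (ratio_num g om v d k.+1 w / ratio_den g om v d k.+1 w).
    by exists k.+1, w.
  rewrite -ler_pdivrMr; last by rewrite lt_neqAle eq_sym den0.
  rewrite Lsup; last by eexists; exact: rM.
  (* The supremum of an unbounded set defaults to zero, which [0 < LN] rules out. *)
  apply: sup_upper_bound => //; apply: contrapT => /sup_out s0.
  by move: L0; rewrite Lsup ?s0 ?ltxx//; eexists; exact: rM.
(* A zero sum of nonnegative terms forces every coefficient of the numerator to vanish, through the
   violation or through the inverse squared norm. *)
rewrite den0 mulr0 /ratio_num big1 ?scaler0 ?enorm0 ?expr0n// => i _.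
move: den0; rewrite /ratio_den => /eqP; rewrite mulf_eq0 gt_eqF//= => h.
move: h; rewrite psumr_eq0; last by move=> j _; rewrite divr_ge0 ?sqr_ge0.
move=> /allP/(_ i (mem_index_enum i))/implyP/(_ isT).
rewrite mulf_eq0 sqrf_eq0 => /orP[|] /eqP ->; first by rewrite mul0r scale0r.
by rewrite mulr0 scale0r.
Qed.

(** With [u] the mean of the scaled subgradients, expand the square of [(vk - y) - beta *: u]. The
    subgradient inequality at the feasible [y] gives [hdot], the constant [LN] gives [hnum], and the
    bound [Mg] on violated directions gives [hden]. *)
Lemma feasibility_step k w y : X y ->
  enorm (x k.+1 w - y) ^+ 2 <= enorm (v k.+1 w - y) ^+ 2
    - beta * (2 - beta * LN) / Mg ^+ 2 *
      (N%:R^-1 * \sum_(i < N) gp (om k.+1 i w) (v k.+1 w) ^+ 2).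
Proof.
move=> Xy; have Yy : Y y by case: Xy.
have Yv := v_in_Y k w; rewrite (x_step halg).
have [/andP[L0 _] _] := hLN; have /andP[b0 b2] := hbeta.
have Nn0 : N%:R != 0 :> R by rewrite pnatr_eq0 -lt0n.
have N0 : 0 < (N%:R^-1 : R) by rewrite invr_gt0 ltr0n.
have := enorm_proj_le cY convY Y_nonempty (zbar g om v d beta k.+1 w) Yy.
set p := Defs.proj _ _.
rewrite -(@ler_pXn2r _ 2) ?nnegrE// => /le_trans; apply.
set vk := v k.+1 w in Yv *.
pose r i := violation g om v k.+1 i w / enorm (d k.+1 i w) ^+ 2.
pose u := N%:R^-1 *: \sum_(i < N) (r i *: d k.+1 i w).
have -> : zbar g om v d beta k.+1 w - y = (vk - y) - beta *: u.
  rewrite /zbar /z sumrB sumr_const card_ord scalerBr.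
  rewrite -[v k.+1 w *+ N]scaler_nat scalerA.
  rewrite mulVf// scale1r addrAC; congr (_ - _).
  rewrite /u scalerA mulrC -scalerA; congr (_ *: _).
  by rewrite scaler_sumr; apply: eq_bigr => i _; rewrite scalerA.
rewrite !enorm_sqr dot_subZ -!enorm_sqr.
have hnum : enorm u ^+ 2 <= LN * ratio_den g om v d k.+1 w.
  exact: minibatch_ratio_le.
have gE i : violation g om v k.+1 i w = gp (om k.+1 i w) vk by [].
have gd i : 0 < gp (om k.+1 i w) vk ->
    subdiff (g (om k.+1 i w))^\+%E vk (d k.+1 i w).
  move=> gi; apply: (d_violated halg).
  by rewrite (g_pos_fin hproblem)// lte_fin.
have hdot : ratio_den g om v d k.+1 w <= dot (vk - y) u.
  rewrite /u dotZr dotC dot_suml ler_pM2l//; apply: ler_sum => i _.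
  rewrite dotZl /r gE expr2 mulrAC.
  have [gi|gi] := ltP 0 (gp (om k.+1 i w) vk); last first.
    have -> : gp (om k.+1 i w) vk = 0.
      by apply/eqP; rewrite eq_le gi gp_ge0.
    by rewrite !mul0r.
  rewrite ler_wpM2l ?divr_ge0 ?sqr_ge0 ?(ltW gi)//.
  have := gp_subgrad hproblem Yv (gd i gi) Yy.
  by rewrite (gp_feasible _ Xy) -(opprB vk y) dotNr subr_le0.
have hden : Mg ^- 2 * (N%:R^-1 * \sum_(i < N) gp (om k.+1 i w) vk ^+ 2) <=
    ratio_den g om v d k.+1 w.
  rewrite mulrCA ler_pM2l// mulr_sumr; apply: ler_sum => i _.
  rewrite gE mulrC.
  have [gi|gi] := ltP 0 (gp (om k.+1 i w) vk); last first.
    have -> : gp (om k.+1 i w) vk = 0.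
      by apply/eqP; rewrite eq_le gi gp_ge0.
    by rewrite expr0n !mul0r.
  rewrite ler_wpM2l ?sqr_ge0// lef_pV2 ?posrE ?exprn_gt0 ?(Mg_gt0 hA)//.
    rewrite lerXn2r ?nnegrE//; first exact: ltW (Mg_gt0 hA).
    exact: (gp_subgrad_le hproblem hA Yv gi (gd i gi)).
  rewrite lt_neqAle enorm_ge0 andbT eq_sym; apply/eqP => /enorm_eq0 d0.
  have := gp_subgrad_neq0 hproblem hA Yv gi (gd i gi).
  by rewrite d0 eqxx.
(* Together [hdot] and [hnum] give a decrease of [beta * (2 - beta * LN)] times [ratio_den];
   positivity of this factor lets [hden] be inserted. *)
have bL : 0 < 2 - beta * LN by rewrite subr_gt0 -ltr_pdivlMr.
have := ler_wpM2l (ltW (mulr_gt0 b0 bL)) hden.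
have := ler_wpM2l (ltW b0) hdot.
have := ler_wpM2l (sqr_ge0 beta) hnum.
lra.
Qed.

End Iterations.

(** * Bounded random variables and their expectations *)

Section BoundedRandomVariables.
Context {R : realType} {dO : measure_display} {Omega : measurableType dO}.
Variable Pr : probability Omega R.
Implicit Types (h : Omega -> R) (B : set Omega).

Definition bounded_rv h :=
  measurable_fun setT h /\ exists M, forall w, `|h w| <= M.

Lemma bounded_rv_cst a : bounded_rv (fun=> a).
Proof. by split; [exact: measurable_cst|exists `|a|]. Qed.

Lemma bounded_rvD h1 h2 :
  bounded_rv h1 -> bounded_rv h2 -> bounded_rv (fun w => h1 w + h2 w).
Proof.
move=> [m1 [M1 b1]] [m2 [M2 b2]]; split; first exact: measurable_funD.
by exists (M1 + M2) => w; apply: le_trans (ler_normD _ _) _; exact: lerD.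
Qed.

Lemma bounded_rvM h1 h2 :
  bounded_rv h1 -> bounded_rv h2 -> bounded_rv (fun w => h1 w * h2 w).
Proof.
move=> [m1 [M1 b1]] [m2 [M2 b2]]; split; first exact: measurable_funM.
by exists (M1 * M2) => w; rewrite normrM; exact: ler_pM.
Qed.

Lemma bounded_rvZ a h : bounded_rv h -> bounded_rv (fun w => a * h w).
Proof. by apply: bounded_rvM; exact: bounded_rv_cst. Qed.

Lemma bounded_rvB h1 h2 :
  bounded_rv h1 -> bounded_rv h2 -> bounded_rv (fun w => h1 w - h2 w).
Proof.
move=> b1 b2; apply: bounded_rvD => //.
by under eq_fun do rewrite -mulN1r; exact: bounded_rvZ.
Qed.

Lemma bounded_rvX2 h : bounded_rv h -> bounded_rv (fun w => h w ^+ 2).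
Proof. by move=> bh; under eq_fun do rewrite expr2; exact: bounded_rvM. Qed.

Lemma bounded_rv_sum I (r : seq I) (P : pred I) (F : I -> Omega -> R) :
  (forall i, bounded_rv (F i)) ->
  bounded_rv (fun w => \sum_(i <- r | P i) F i w).
Proof.
move=> bF; elim: r => [|i r IH].
  by under eq_fun do rewrite big_nil; exact: bounded_rv_cst.
under eq_fun do rewrite big_cons.
by case: (P i) => //; exact: bounded_rvD.
Qed.

Lemma bounded_rv_integrable B h : measurable B -> bounded_rv h ->
  Pr.-integrable B (EFin \o h).
Proof.
move=> mB [mh [M hM]]; apply: measurable_bounded_integrable => //.
- by rewrite (le_lt_trans (probability_le1 _ _))// ltry.
- exact: measurable_funS mh.
- exists M; split; first exact: num_real.
  by move=> r Mr w _ /=; apply: le_trans (hM w) (ltW Mr).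
Qed.

Lemma bounded_rv_integralE h : bounded_rv h ->
  (\int[Pr]_w (h w)%:E)%E = (\int[Pr]_w h w)%R%:E.
Proof.
move=> bh; rewrite /Rintegral fineK//.
exact: (integrable_fin_num measurableT (bounded_rv_integrable measurableT bh)).
Qed.

Lemma expectD h1 h2 : bounded_rv h1 -> bounded_rv h2 ->
  \int[Pr]_w (h1 w + h2 w) = \int[Pr]_w h1 w + \int[Pr]_w h2 w.
Proof. by move=> b1 b2; apply: RintegralD => //; exact: bounded_rv_integrable. Qed.

Lemma expectB h1 h2 : bounded_rv h1 -> bounded_rv h2 ->
  \int[Pr]_w (h1 w - h2 w) = \int[Pr]_w h1 w - \int[Pr]_w h2 w.
Proof. by move=> b1 b2; apply: RintegralB => //; exact: bounded_rv_integrable. Qed.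

Lemma expectZ a h : bounded_rv h ->
  \int[Pr]_w (a * h w) = a * \int[Pr]_w h w.
Proof. by move=> bh; apply: RintegralZl => //; exact: bounded_rv_integrable. Qed.

Lemma expect_cst a : \int[Pr]_w a = a.
Proof.
rewrite Rintegral_cst//= (_ : Pr setT = 1%E) ?mulr1//.
exact: probability_setT.
Qed.

Lemma le_expect h1 h2 : bounded_rv h1 -> bounded_rv h2 ->
  (forall w, h1 w <= h2 w) -> \int[Pr]_w h1 w <= \int[Pr]_w h2 w.
Proof.
by move=> b1 b2 h12; apply: le_Rintegral => //; exact: bounded_rv_integrable.
Qed.

Lemma expect_sum I (r : seq I) (F : I -> Omega -> R) :
  (forall i, bounded_rv (F i)) ->
  \int[Pr]_w (\sum_(i <- r) F i w) = \sum_(i <- r) \int[Pr]_w F i w.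
Proof.
move=> bF; elim: r => [|i r IH].
  by under eq_Rintegral do rewrite big_nil; rewrite expect_cst big_nil.
under eq_Rintegral do rewrite big_cons.
by rewrite big_cons expectD ?IH//; exact: bounded_rv_sum.
Qed.

(** On [Y], each strict sublevel set of [h] is the trace of an open set, so Borel measurability of
    [u] suffices although [h] is controlled on [Y] only. *)
Lemma measurable_lipschitz n (Y : set 'rV[R]_n) (h : 'rV[R]_n -> R)
    (u : Omega -> 'rV[R]_n) K : 0 < K ->
  (forall y z, Y y -> Y z -> h y <= h z + K * enorm (y - z)) ->
  (forall w, Y (u w)) -> vector_measurable measurable u ->
  measurable_fun setT (h \o u).
Proof.
move=> K0 hK Yu mu; apply: (measurability _ (RGenInftyO.measurableE R)) => //.
move=> _ [_ [a ->] <-]; rewrite setTI.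
(* The Lipschitz bound keeps [h] below [a] on the part of each ball lying in [Y]; when [a <= h z]
   the ball is empty. *)
pose U := \bigcup_(z in Y) [set y | enorm (z - y) < (a - h z) / K].
suff -> : (h \o u) @^-1` `]-oo, a[ = u @^-1` U.
  apply: mu; apply: sub_sigma_algebra.
  by apply: bigcup_open => z _; exact: open_enorm_lt.
apply/seteqP; split => w /=; rewrite in_itv/=.
  move=> hwa; exists (u w) => //=.
  by rewrite subrr enorm0 divr_gt0// subr_gt0.
move=> [z Yz /=]; rewrite ltr_pdivlMr// enormB => hz.
by apply: le_lt_trans (hK _ _ (Yu w) Yz) _; lra.
Qed.

Lemma bounded_rv_lipschitz n (Y : set 'rV[R]_n) (h : 'rV[R]_n -> R)
    (u : Omega -> 'rV[R]_n) K D y0 : 0 < K ->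
  (forall y z, Y y -> Y z -> enorm (y - z) <= D) -> Y y0 ->
  (forall y z, Y y -> Y z -> h y <= h z + K * enorm (y - z)) ->
  (forall w, Y (u w)) -> vector_measurable measurable u ->
  bounded_rv (fun w => h (u w)).
Proof.
move=> K0 YD Yy0 hK Yu mu; split; first exact: measurable_lipschitz hK Yu mu.
exists (`|h y0| + K * D) => w.
have /(ler_wpM2l (ltW K0)) := YD _ _ (Yu w) Yy0.
have := hK _ _ (Yu w) Yy0; have := hK _ _ Yy0 (Yu w); rewrite (enormB y0).
have := ler_norm (h y0); have := ler_norm (- h y0); rewrite normrN.
rewrite ler_norml; lra.
Qed.

End BoundedRandomVariables.

(** * Assumption B at a random point determined by the past *)

Section Freezing.
Context {R : realType} {n N : nat}.
Context {dA : measure_display} {A : measurableType dA}.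
Context {dO : measure_display} {Omega : measurableType dO}.
Variables (Pr : probability Omega R).
Variables (f : 'rV[R]_n -> \bar R) (g : A -> 'rV[R]_n -> \bar R).
Variables (Y : set 'rV[R]_n) (mu Mf Mg c : R).
Variables (sf : 'rV[R]_n -> 'rV[R]_n) (om : nat -> 'I_N -> {RV Pr >-> A}).
Variables (x : nat -> Omega -> 'rV[R]_n).
Hypothesis hN : (1 <= N)%N.
Hypothesis hproblem : convex_problem f g Y.
Hypothesis hA : assumption_A f g Y mu Mf Mg.
Hypothesis sfP : forall y, Y y -> subdiff f y (sf y).
Hypothesis subgP : forall a y, Y y -> (0 < (g a)^\+ y)%E ->
  subdiff (g a)^\+%E y !=set0.
Hypothesis x0_measurable : vector_measurable measurable (x 0%N).
Hypothesis hc : 0 < c.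
Hypothesis hB : assumption_B g Y om x c.

Let X := feasible g Y.
Let gp a y : R := fine ((g a)^\+%E y).
Let D : R := 4 * Mf / mu.

Let Mg0 : 0 < Mg. Proof. exact: Mg_gt0 hA. Qed.
Let D0 : 0 < D.
Proof. by rewrite divr_gt0 ?mulr_gt0 ?(mu_gt0 hA) ?(Mf_gt0 hA). Qed.
Let X0 : X !=set0. Proof. exact: feasible_nonempty hA. Qed.

Lemma history_measurable k : history om x k `<=` measurable.
Proof.
apply: smallest_sub; first exact: sigma_algebra_measurable.
move=> B [[C bC <-]|[t _ [j _ [C mC <-]]]]; rewrite setTI.
  exact: x0_measurable.
by rewrite -[X in measurable X]setTI; exact: measurable_funPT.
Qed.

Lemma history_setI k B C :
  history om x k B -> history om x k C -> history om x k (B `&` C).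
Proof. exact: (@measurableI _ (g_sigma_algebraType _)). Qed.

Lemma history_setD k B C :
  history om x k B -> history om x k C -> history om x k (B `\` C).
Proof. exact: (@measurableD _ (g_sigma_algebraType _)). Qed.

Lemma history_setT k : history om x k setT.
Proof. exact: (@measurableT _ (g_sigma_algebraType _)). Qed.

Lemma dist_feasible_le y : Y y -> dist y X <= D.
Proof.
move=> Yy; have [z Xz] := X0; apply: le_trans (dist_le _ Xz) _.
by apply: (Y_diameter hproblem hA sfP) => //; case: Xz.
Qed.

Lemma gp_le a y : Y y -> gp a y <= Mg * D.
Proof.
move=> Yy; have [z Xz] := X0; have Yz : Y z by case: Xz.
apply: le_trans (gp_lipschitz hproblem hA subgP a Yy Yz) _.
rewrite -/gp (gp_feasible a Xz) add0r ler_wpM2l ?(ltW Mg0)//.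
exact: (Y_diameter hproblem hA sfP).
Qed.

Lemma bounded_rv_gp k i y : Y y ->
  bounded_rv (fun w => gp (om k i w) y ^+ 2).
Proof.
move=> Yy; apply: bounded_rvX2; split; last first.
  by exists (Mg * D) => w; rewrite ger0_norm ?gp_ge0//; exact: gp_le.
apply: (@measurableT_comp _ _ _ _ _ _ (fun a => gp a y)) => //.
apply/measurable_EFinP.
rewrite (_ : EFin \o _ = (fun a => maxe (g a y) 0%E)).
  by apply: measurable_maxe; [exact: (measurable_g hproblem)|exact: measurable_cst].
by apply/funext => a /=; rewrite -(g_pos_fin hproblem)// funeposE.
Qed.

(** Integrate the almost sure inequality over the past event [B], where the conditional expectation
    has the same integral as the squared violation. Index [k.+1] is paired with [history om x k]. *)
Lemma assumption_B_integral k i y B : Y y -> history om x k B ->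
  \int[Pr]_(w in B) (dist y X ^+ 2) <=
  c * \int[Pr]_(w in B) (gp (om k.+1 i w) y ^+ 2).
Proof.
move=> Yy hBk; have [Z [[Z0 mZ intZ] aeZ]] := hB i Yy (ltn0Sn k).
have mB := history_measurable hBk.
have bG := bounded_rv_gp k.+1 i Yy.
have iG := bounded_rv_integrable Pr mB bG.
have mZT : measurable_fun setT Z.
  by move=> _ C mC; rewrite setTI; apply: (@history_measurable k); exact: mZ.
have ic := bounded_rv_integrable Pr mB (bounded_rv_cst (dist y X ^+ 2)).
rewrite -lee_fin EFinM /Rintegral.
rewrite (fineK (integrable_fin_num mB ic)) (fineK (integrable_fin_num mB iG)).
have -> : (\int[Pr]_(w in B) (gp (om k.+1 i w) y ^+ 2)%:E =
    \int[Pr]_(w in B) Z w)%E.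
  rewrite intZ//; apply: eq_integral => w _.
  by rewrite (g_pos_fin hproblem)// -EFin_expe.
rewrite -ge0_integralZl_EFin//; last 2 first.
- exact: measurable_funS mZT.
- exact: ltW.
apply: ae_ge0_le_integral => //.
- by move=> w _; rewrite lee_fin sqr_ge0.
- exact: measurable_cst.
- by move=> w _; rewrite mule_ge0// lee_fin ltW.
- by apply: measurable_funeM; exact: measurable_funS mZT.
- by apply: filterS aeZ => w.
Qed.

(** Linearity of the integral averages the bounds of the single indices, whatever their joint
    dependence. *)
Lemma assumption_B_mean k y B : Y y -> history om x k B ->
  \int[Pr]_(w in B) (dist y X ^+ 2) <=
  c * \int[Pr]_(w in B) (N%:R^-1 * \sum_(i < N) gp (om k.+1 i w) y ^+ 2).
Proof.
move=> Yy hBk; have mB := history_measurable hBk.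
have Nn0 : N%:R != 0 :> R by rewrite pnatr_eq0 -lt0n.
have bG i := bounded_rv_gp k.+1 i Yy.
have bS (r : seq 'I_N) :
    bounded_rv (fun w => \sum_(i <- r) gp (om k.+1 i w) y ^+ 2).
  exact: bounded_rv_sum.
have intS (r : seq 'I_N) :
    \int[Pr]_(w in B) (\sum_(i <- r) gp (om k.+1 i w) y ^+ 2) =
    \sum_(i <- r) \int[Pr]_(w in B) (gp (om k.+1 i w) y ^+ 2).
  elim: r => [|i r IH].
    under eq_Rintegral do rewrite big_nil.
    by rewrite Rintegral_cst// mul0r big_nil.
  under eq_Rintegral do rewrite big_cons.
  rewrite big_cons -IH RintegralD//; first exact: bounded_rv_integrable.
  exact: bounded_rv_integrable mB (bS _).
rewrite [X in c * X]RintegralZl//; last exact: bounded_rv_integrable.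
rewrite intS.
rewrite mulrCA -ler_pdivrMl ?invr_gt0 ?ltr0n// invrK mulr_sumr.
rewrite mulr_natl -[X in _ *+ X](card_ord N) -sumr_const.
by apply: ler_sum => i _; exact: assumption_B_integral.
Qed.

(* Assumption B holds at each fixed point, and the indices need not be
   independent of the past, so it is transferred to a random point [u] known
   from the past by cutting Y into finitely many small pieces and freezing [u]
   on each of them; the Lipschitz bounds control the error. *)
Lemma freezing k (u : Omega -> 'rV[R]_n) (H : Omega -> R) :
  vector_measurable (history om x k) u -> (forall w, Y (u w)) ->
  bounded_rv H ->
  (forall w, N%:R^-1 * \sum_(i < N) gp (om k.+1 i w) (u w) ^+ 2 <= H w) ->
  \int[Pr]_w (dist (u w) X ^+ 2) <= c * \int[Pr]_w H w.
Proof.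
move=> hu Yu bH GH.
have mu' : vector_measurable measurable u.
  by move=> B /hu; exact: history_measurable.
have Nn0 : N%:R != 0 :> R by rewrite pnatr_eq0 -lt0n.
have Ni0 : 0 < N%:R^-1 :> R by rewrite invr_gt0 ltr0n.
have [z0 Xz0] := X0; have Yz0 : Y z0 by case: Xz0.
have bd : bounded_rv (fun w => dist (u w) X ^+ 2).
  apply: bounded_rvX2.
  apply: (@bounded_rv_lipschitz _ _ _ _ Y (fun y => dist y X) u 1 D z0) => //.
    exact: (Y_diameter hproblem hA sfP).
  by move=> y z _ _; rewrite mul1r; exact: dist_lipschitz.
(* Total error per unit radius: [2 * D] from the squared distance and [2 * Mg * D * Mg], multiplied
   by [c], from the squared violations. *)
pose K := 2 * D + c * (2 * Mg * D * Mg).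
have K0 : 0 < K.
  have := mulr_gt0 hc (mulr_gt0 (mulr_gt0 Mg0 D0) Mg0).
  rewrite /K; have := D0; lra.
apply/ler_addgt0Pr => _ /posnumP[e'].
pose e := e'%:num / K; have e0 : 0 < e by rewrite /e divr_gt0.
have -> : e'%:num = K * e by rewrite /e; field; rewrite gt_eqF.
pose W w := c * H w + K * e - dist (u w) X ^+ 2.
have bW : bounded_rv W.
  apply: bounded_rvB => //.
  by apply: bounded_rvD; [exact: bounded_rvZ|exact: bounded_rv_cst].
have piece y B : Y y -> history om x k B ->
    (forall w, B w -> enorm (y - u w) < e) -> 0 <= \int[Pr]_(w in B) W w.
  move=> Yy hBk Be; have mB := history_measurable hBk.
  pose G w := N%:R^-1 * \sum_(i < N) gp (om k.+1 i w) y ^+ 2.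
  have bG : bounded_rv G.
    by apply: bounded_rvZ; apply: bounded_rv_sum => i; exact: bounded_rv_gp.
  have bcG : bounded_rv (fun w => c * G w) by exact: bounded_rvZ.
  apply: (@le_trans _ _ (\int[Pr]_(w in B) (c * G w - dist y X ^+ 2))).
    rewrite RintegralB//; last 2 first.
    - exact: bounded_rv_integrable.
    - by apply: bounded_rv_integrable => //; exact: bounded_rv_cst.
    rewrite subr_ge0 [leRHS]RintegralZl//; last exact: bounded_rv_integrable.
    exact: assumption_B_mean.
  apply: le_Rintegral => //.
  - apply: bounded_rv_integrable => //; apply: bounded_rvB => //.
    exact: bounded_rv_cst.
  - exact: bounded_rv_integrable.
  move=> w Bw; have yu := ltW (Be _ Bw).
  (* Difference of two squares: the bases lie between 0 and [D], and the first exceeds the second by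
     at most [e]. The bound [hG] repeats this with [Mg * D] and [Mg * e]. *)
  have hd : dist (u w) X ^+ 2 <= dist y X ^+ 2 + 2 * D * e.
    have := dist_ge0 X0 (u w); have := dist_ge0 X0 y.
    have := dist_feasible_le (Yu w); have := dist_feasible_le Yy.
    have := dist_lipschitz X0 (u w) y; rewrite enormB => h1 h2 h3 h4 h5.
    have h6 : dist (u w) X <= dist y X + e by lra.
    nra.
  have hG : G w <= H w + 2 * Mg * D * Mg * e.
    apply: le_trans (lerD (GH w) (lexx _)); rewrite -ler_pdivlMl// invrK.
    rewrite mulrDr mulVKf//.
    rewrite [X in _ + X]mulr_natl -[X in _ *+ X](card_ord N) -sumr_const.
    rewrite -big_split/=; apply: ler_sum => i _.
    have := gp_ge0 g (om k.+1 i w) y; have := gp_ge0 g (om k.+1 i w) (u w).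
    have := gp_le (om k.+1 i w) Yy; have := gp_le (om k.+1 i w) (Yu w).
    have := gp_lipschitz hproblem hA subgP (om k.+1 i w) Yy (Yu w).
    rewrite -/(gp _ _) -/(gp _ _).
    have := ler_wpM2l (ltW Mg0) yu.
    set a := gp _ _; set b := gp _ _.
    set q := Mg * e => h0 h1 h2 h3 h4 h5.
    have h6 : a <= b + q by lra.
    have -> : 2 * Mg * D * Mg * e = 2 * (Mg * D) * q by rewrite /q; ring.
    have q0 : 0 <= q by rewrite mulr_ge0// ltW.
    nra.
  have := ler_wpM2l (ltW hc) hG; rewrite /W /K; lra.
(* Induction on the list of centres: the part of [B] where [u] is near the first centre is a piece,
   and the rest is left to the other centres. Both parts stay in the history because [u] is
   measurable for it. *)
have cover (l : seq 'rV[R]_n) B : {in l, forall y, Y y} -> history om x k B ->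
    (forall w, B w -> exists2 y, y \in l & enorm (y - u w) < e) ->
    0 <= \int[Pr]_(w in B) W w.
  elim: l B => [|y l IH] B Yl hBk cB.
    have -> : B = set0 by rewrite -subset0 => w /cB[].
    by rewrite Rintegral_set0.
  pose C := u @^-1` [set z | enorm (y - z) < e].
  have hC : history om x k C.
    by apply: hu; apply: sub_sigma_algebra; exact: open_enorm_lt.
  have mB := history_measurable hBk; have mC := history_measurable hC.
  have -> : B = (B `&` C) `|` (B `\` C) by rewrite setUIDK.
  rewrite Rintegral_setU//; last 4 first.
  - exact: measurableI.
  - exact: measurableD.
  - by apply: bounded_rv_integrable => //; rewrite setUIDK.
  - by apply/disj_setPS => w [[_ Cw] [_]].
  apply: addr_ge0.
    apply: (piece y); first by apply: Yl; rewrite mem_head.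
      exact: history_setI.
    by move=> w [].
  apply: IH; first by move=> z zl; apply: Yl; rewrite in_cons zl orbT.
    exact: history_setD.
  move=> w [Bw Cw]; have [z] := cB _ Bw; rewrite in_cons => /orP[/eqP ->|zl] zu.
    by exfalso; exact: Cw.
  by exists z.
have : 0 <= \int[Pr]_w W w.
  (* Compactness of [Y] extracts finitely many balls of radius [e] that cover all values of [u]. *)
  have := compact_Y hproblem hA sfP; rewrite compact_cover.
  case/(_ _ Y (fun y : 'rV[R]_n => [set z | enorm (y - z) < e])).
  - by move=> y _; exact: open_enorm_lt.
  - by move=> y Yy; exists y => //=; rewrite subrr enorm0.
  move=> l lY Yl; apply: (cover (finmap.enum_fset l)).
  - by move=> y yl; have := lY y yl; rewrite inE.
  - exact: history_setT.
  - by move=> w _; have [y /= yl yu] := Yl _ (Yu w); exists y.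
rewrite /W expectB//; last first.
  by apply: bounded_rvD; [exact: bounded_rvZ|exact: bounded_rv_cst].
rewrite expectD; [|exact: bounded_rvZ|exact: bounded_rv_cst].
by rewrite expectZ// expect_cst subr_ge0.
Qed.

End Freezing.

Local Ltac nonneg := do ?[done | apply: addr_ge0 | apply: divr_ge0
  | apply: mulr_ge0 | apply: exprn_ge0].

(** * The deterministic recursion behind the rates *)

Section WeightedRecursion.
Context {R : realType}.

Lemma weight_sum_ge t : t%:R ^+ 3 / 3 <= weight_sum t :> R.
Proof.
elim: t => [|t IH]; first by rewrite /weight_sum big_geq// expr0n mul0r.
rewrite /weight_sum big_nat_recr//= -/(weight_sum t).
have := ler0n R t.
rewrite -(@natr1 R t.+1) -(@natr1 R t); nra.
Qed.

Lemma sum_succ_le t : \sum_(1 <= k < t.+1) (k.+1%:R : R) <= 2 * t%:R ^+ 2.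
Proof.
elim: t => [|t IH]; first by rewrite big_geq// expr0n mulr0.
rewrite big_nat_recr//=; have := ler0n R t.
rewrite -(@natr1 R t.+1) -(@natr1 R t); nra.
Qed.

(** These stand for the expectations of the squared distance of [x k] to an optimum, the gap at
    [x k], and the squared and plain distances of [v k.+1] to the feasible set. *)
Variables (a phi del e : nat -> R) (mu Mf q : R).
Hypotheses (mu0 : 0 < mu) (Mf0 : 0 < Mf) (q0 : 0 < q).
Let alpha k : R := 4 / (mu * k.+1%:R).
Hypothesis a0 : forall k, 0 <= a k.
Hypothesis del0 : forall k, 0 <= del k.
Hypothesis arec : forall k, a k.+1 <=
  (1 - alpha k * mu) * a k - 2 * alpha k * phi k + (alpha k * Mf) ^+ 2 - q * del k.
Hypothesis phi_ge : forall k, - (Mf * (e k + alpha k * Mf)) <= phi k.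
Hypothesis e_le : forall k s, 0 < s -> 2 * e k <= s * del k + s^-1.

Lemma weighted_step k : k.+1%:R ^+ 3 * a k.+1 <= k%:R ^+ 3 * a k
  - 8 / mu * (k.+1%:R ^+ 2 * phi k) + 16 * Mf ^+ 2 / mu ^+ 2 * k.+1%:R
  - q * (k.+1%:R ^+ 3 * del k).
Proof.
have k0 := ler0n R k; have K0 : 0 < k.+1%:R :> R by rewrite ltr0n.
have := ler_wpM2l (ltW (exprn_gt0 3 K0)) (arec k).
have -> : k.+1%:R ^+ 3 * ((1 - alpha k * mu) * a k - 2 * alpha k * phi k +
    (alpha k * Mf) ^+ 2 - q * del k) =
  k.+1%:R ^+ 2 * (k.+1%:R - 4) * a k - 8 / mu * (k.+1%:R ^+ 2 * phi k) +
  16 * Mf ^+ 2 / mu ^+ 2 * k.+1%:R - q * (k.+1%:R ^+ 3 * del k).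
  by rewrite /alpha; field; rewrite !gt_eqF.
(* The difference of the two coefficients of [a k] is [k ^+ 2 + 5 * k + 3]. *)
have : k.+1%:R ^+ 2 * (k.+1%:R - 4) * a k <= k%:R ^+ 3 * a k.
  by rewrite ler_wpM2r// -(@natr1 R k); nra.
lra.
Qed.

Lemma weighted_telescope t :
  8 / mu * (\sum_(1 <= k < t.+1) k.+1%:R ^+ 2 * phi k) +
  q * (\sum_(1 <= k < t.+1) k.+1%:R ^+ 3 * del k) <=
  a 1%N + 16 * Mf ^+ 2 / mu ^+ 2 * \sum_(1 <= k < t.+1) k.+1%:R.
Proof.
(* The nonnegative boundary term is kept to make the induction go through, and dropped afterwards.
   Starting at index 1 leaves [a 1] as initial value. *)
suff : t.+1%:R ^+ 3 * a t.+1 +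
    8 / mu * (\sum_(1 <= k < t.+1) k.+1%:R ^+ 2 * phi k) +
    q * (\sum_(1 <= k < t.+1) k.+1%:R ^+ 3 * del k) <=
    a 1%N + 16 * Mf ^+ 2 / mu ^+ 2 * \sum_(1 <= k < t.+1) k.+1%:R.
  have : 0 <= t.+1%:R ^+ 3 * a t.+1 by rewrite mulr_ge0.
  lra.
elim: t => [|t IH]; first by rewrite !big_geq// !mulr0 !addr0 expr1n mul1r.
rewrite !(big_nat_recr t.+1)//= !(mulrDr (_ / mu)) (mulrDr q) (mulrDr (_ / _ ^+ 2)).
have := weighted_step t.+1; lra.
Qed.

(** The hypothesis [e_le] is used twice: with [s = l * k.+1] to absorb the negative part of [phi]
    into half of the distance term, then with [s = k.+1] to recover the first powers [e k]. *)
Lemma weighted_bounds : exists2 C, 0 < C & forall t, (0 < t)%N ->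
  \sum_(1 <= k < t.+1) k.+1%:R ^+ 2 * phi k <= C * t%:R ^+ 2 /\
  \sum_(1 <= k < t.+1) k.+1%:R ^+ 2 * (e k + alpha k * Mf) <= C * t%:R ^+ 2.
Proof.
(* Chosen so that [4 * Mf / mu * l = q / 2]. *)
pose l := q * mu / (8 * Mf).
have l0 : 0 < l by apply: divr_gt0; exact: mulr_gt0.
pose B := 4 * Mf / (mu * l) + 32 * Mf ^+ 2 / mu ^+ 2.
pose B' := 16 * Mf ^+ 2 / mu ^+ 2.
have [mu_ge0 Mf_ge0 q_ge0 l_ge0] := And4 (ltW mu0) (ltW Mf0) (ltW q0) (ltW l0).
have B0 : 0 <= B by rewrite /B; nonneg.
have B'0 : 0 <= B' by rewrite /B'; nonneg.
pose C1 := mu / 8 * (a 1%N + B' * 2).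
pose C2 := (a 1%N + (B + B') * 2) / q + 1 + 4 * Mf / mu * 2.
have C10 : 0 <= C1.
  by rewrite /C1; nonneg.
have C20 : 0 < C2.
  have h1 : 0 <= (a 1%N + (B + B') * 2) / q.
    by nonneg.
  have h2 : 0 <= 4 * Mf / mu * 2 by nonneg.
  by rewrite /C2; lra.
exists (C1 + C2) => [|t t0]; first lra.
set T2 := _ ^+ 2.
have T1 : 1 <= T2.
  by rewrite /T2 exprn_ege1// ler1n.
have hS := sum_succ_le t; rewrite -/T2 in hS.
set S := \sum_(1 <= k < t.+1) _ in hS.
have htel := weighted_telescope t; rewrite -/B' -/S in htel.
set P := \sum_(1 <= k < t.+1) _ in htel *.
set Q := \sum_(1 <= k < t.+1) _ in htel *.
have Q0 : 0 <= Q by rewrite sumr_ge0// => k _; rewrite mulr_ge0.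
have aT : a 1%N <= a 1%N * T2 by rewrite ler_peMr.
have BS : B' * S <= B' * (2 * T2) by rewrite ler_wpM2l.
have BS2 : B * S <= B * (2 * T2) by rewrite ler_wpM2l.
(* Inserted in the telescoped inequality, this leaves the half [q / 2 * Q] bounded by terms of order
   [t ^+ 2]. *)
have hP : - (8 / mu * P) <= q / 2 * Q + B * S.
  rewrite /P /Q /S !mulr_sumr -sumrN -big_split/=; apply: ler_sum => k _.
  have K0 : 0 < k.+1%:R :> R by rewrite ltr0n.
  have h1 := ler_wpM2l (sqr_ge0 k.+1%:R) (phi_ge k).
  have h2 := ler_wpM2l (sqr_ge0 k.+1%:R) (e_le k (mulr_gt0 l0 K0)).
  have c1 : 0 <= 8 / mu by nonneg.
  have c2 : 0 <= 4 * Mf / mu by nonneg.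
  have h3 := ler_wpM2l c1 h1; have h4 := ler_wpM2l c2 h2.
  have E3 : 8 / mu * (k.+1%:R ^+ 2 * - (Mf * (e k + alpha k * Mf))) =
    - (4 * Mf / mu * (k.+1%:R ^+ 2 * (2 * e k)))
    - 32 * Mf ^+ 2 / mu ^+ 2 * k.+1%:R.
    by rewrite /alpha; field; rewrite !gt_eqF.
  have E4 : 4 * Mf / mu * (k.+1%:R ^+ 2 * (l * k.+1%:R * del k +
    (l * k.+1%:R)^-1)) = q / 2 * (k.+1%:R ^+ 3 * del k) +
    4 * Mf / (mu * l) * k.+1%:R.
    by rewrite /l; field; rewrite !gt_eqF.
  move: h3 h4; rewrite E3 E4 /B; lra.
have hQ : q / 2 * Q <= a 1%N + (B + B') * S by lra.
split.
  have : 8 / mu * P <= (a 1%N + B' * 2) * T2.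
    have : 0 <= q * Q by rewrite mulr_ge0// ltW.
    lra.
  rewrite -ler_pdivlMl ?divr_gt0// invf_div mulrA -/C1.
  have : 0 <= C2 * T2 by rewrite mulr_ge0 ?(ltW C20)//; lra.
  lra.
have hE : \sum_(1 <= k < t.+1) k.+1%:R ^+ 2 * (e k + alpha k * Mf) <=
    2^-1 * Q + 2^-1 * S + 4 * Mf / mu * S.
  rewrite /Q /S !mulr_sumr -!big_split/=; apply: ler_sum => k _.
  have K0 : 0 < k.+1%:R :> R by rewrite ltr0n.
  have := ler_wpM2l (sqr_ge0 k.+1%:R) (e_le k K0).
  have -> : k.+1%:R ^+ 2 * (k.+1%:R * del k + k.+1%:R^-1) =
    k.+1%:R ^+ 3 * del k + k.+1%:R by field; rewrite gt_eqF.
  have -> : k.+1%:R ^+ 2 * (e k + alpha k * Mf) =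
    k.+1%:R ^+ 2 * e k + 4 * Mf / mu * k.+1%:R.
    by rewrite /alpha; field; rewrite !gt_eqF.
  lra.
have hQ2 : 2^-1 * Q <= (a 1%N + (B + B') * 2) / q * T2.
  rewrite mulrAC ler_pdivlMr//.
  lra.
have : 4 * Mf / mu * S <= 4 * Mf / mu * (2 * T2).
  by apply: ler_wpM2l => //; nonneg.
have : 0 <= C1 * T2 by rewrite mulr_ge0//; lra.
move: hE hQ2; rewrite /C2; clearbody C1 S Q T2.
move: (_ / q) (4 * Mf / mu) => V G; lra.
Qed.

End WeightedRecursion.

(** The integral of a nonnegative function is a supremum over simple functions below it, hence
    monotone. This bounds the quantities at [average] by sums of bounded random variables. *)
Lemma ge0_le_integral_nonmeasurable d (T : measurableType d) (R : realType)
    (m : {measure set T -> \bar R}) (h1 h2 : T -> \bar R) :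
  (forall w, 0 <= h1 w)%E -> (forall w, h1 w <= h2 w)%E ->
  (\int[m]_w h1 w <= \int[m]_w h2 w)%E.
Proof.
move=> h10 h12; have h20 w : (0 <= h2 w)%E by exact: le_trans (h10 w) (h12 w).
rewrite !ge0_integralTE//; apply: ereal_sup_le => _ [h hh1 <-].
by exists h => // w; exact: le_trans (hh1 w) (h12 w).
Qed.

(** * Expected recursion and rates of the averaged iterates *)

Section Rate.
Context {R : realType} {n N : nat}.
Context {dA : measure_display} {A : measurableType dA} (PA : probability A R).
Context {dO : measure_display} {Omega : measurableType dO}.
Variables (Pr : probability Omega R).
Variables (f : 'rV[R]_n -> \bar R) (g : A -> 'rV[R]_n -> \bar R).
Variables (Y : set 'rV[R]_n) (mu Mf Mg c beta LN : R) (alpha : nat -> R).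
Variables (sf : 'rV[R]_n -> 'rV[R]_n) (om : nat -> 'I_N -> {RV Pr >-> A}).
Variables (x v : nat -> Omega -> 'rV[R]_n) (d : nat -> 'I_N -> Omega -> 'rV[R]_n).
Hypothesis hN : (1 <= N)%N.
Hypothesis hproblem : convex_problem f g Y.
Hypothesis hA : assumption_A f g Y mu Mf Mg.
Hypothesis halg : parallel_algorithm f g Y om x v d PA alpha beta sf.
Hypothesis hc : 0 < c.
Hypothesis hB : assumption_B g Y om x c.
Hypothesis halpha : forall k, alpha k = 4 / (mu * k.+1%:R).
Hypothesis hLN : is_minibatch_constant g om v d LN.
Hypothesis hbeta : 0 < beta < 2 / LN.

Let X := feasible g Y.
Let fr y : R := fine (f y).
Let fstar : R := fine (optimal_value f g Y).
Let q : R := beta * (2 - beta * LN) / (c * Mg ^+ 2).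
Let sfP := sf_subgradient halg.
Let subgP := subgradients_exist halg.
Let X0 : X !=set0. Proof. exact: feasible_nonempty hA. Qed.
Let mu0 : 0 < mu. Proof. exact: mu_gt0 hA. Qed.
Let Mf0 : 0 < Mf. Proof. exact: Mf_gt0 hA. Qed.
Let Mg0 : 0 < Mg. Proof. exact: Mg_gt0 hA. Qed.
Let x0m := x0_random halg.

Let alpha0 k : 0 <= alpha k.
Proof. by rewrite halpha divr_ge0// mulr_ge0// ltW. Qed.

Let kappa_gt0 : 0 < beta * (2 - beta * LN).
Proof.
have [/andP[L0 _] _] := hLN; have /andP[b0 b2] := hbeta.
by rewrite mulr_gt0// subr_gt0 -ltr_pdivlMr.
Qed.

Lemma rate_gt0 : 0 < q.
Proof. by rewrite /q divr_gt0// mulr_gt0// exprn_gt0. Qed.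

(** Multiplied by [LN], the numerator of [q] is [1 - (1 - beta * LN) ^+ 2], at most 1. *)
Lemma rate_lt1 : 1 < c * Mg ^+ 2 * LN -> q < 1.
Proof.
have [/andP[L0 _] _] := hLN => hcond.
rewrite /q ltr_pdivrMr ?mulr_gt0 ?exprn_gt0// mul1r.
rewrite -(ltr_pM2r L0); apply: le_lt_trans hcond.
have := sqr_ge0 (1 - beta * LN); nra.
Qed.

Let x_history k : vector_measurable (history om x k) (x k).
Proof. by move=> B bB; apply: (x_adapted halg). Qed.

Let v_history k : vector_measurable (history om x k) (v k.+1).
Proof. by move=> B bB; apply: (v_adapted halg). Qed.

Let x_measurable k : vector_measurable measurable (x k).
Proof. by move=> B /(@x_history k); exact: (history_measurable x0m). Qed.

Let v_measurable k : vector_measurable measurable (v k.+1).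
Proof. by move=> B /(@v_history k); exact: (history_measurable x0m). Qed.

Let xY := x_in_Y hproblem hA halg.
Let vY := v_in_Y hproblem hA halg.

Lemma bounded_rv_iterate (u : Omega -> 'rV[R]_n) h K : 0 < K ->
  (forall w, Y (u w)) -> vector_measurable measurable u ->
  (forall y z, Y y -> Y z -> h y <= h z + K * enorm (y - z)) ->
  bounded_rv (fun w => h (u w)).
Proof.
move=> K0 Yu mu' hK; have [z [Yz _]] := X0.
by apply: (bounded_rv_lipschitz K0 (Y_diameter hproblem hA sfP) Yz hK Yu).
Qed.

Lemma bounded_rv_dist (u : Omega -> 'rV[R]_n) :
  (forall w, Y (u w)) -> vector_measurable measurable u ->
  bounded_rv (fun w => dist (u w) X).
Proof.
move=> Yu mu'; apply: (bounded_rv_iterate (h := fun y => dist y X) ltr01) => //.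
by move=> y z _ _; rewrite mul1r; exact: dist_lipschitz.
Qed.

Lemma bounded_rv_sqdist (u : Omega -> 'rV[R]_n) z :
  (forall w, Y (u w)) -> vector_measurable measurable u ->
  bounded_rv (fun w => enorm (u w - z) ^+ 2).
Proof.
move=> Yu mu'; apply: bounded_rvX2.
apply: (bounded_rv_iterate (h := fun y => enorm (y - z)) ltr01) => //.
move=> y y' _ _; rewrite mul1r [leRHS]addrC; exact: enorm_triangle.
Qed.

Lemma bounded_rv_gap k : bounded_rv (fun w => fr (x k w) - fstar).
Proof.
apply: bounded_rvD; last exact: bounded_rv_cst.
apply: (bounded_rv_iterate (h := fr) Mf0) => //.
exact: (f_lipschitz hproblem hA sfP).
Qed.

Lemma iteration_step xs k : X xs -> fr xs = fstar ->
  \int[Pr]_w (enorm (x k.+1 w - xs) ^+ 2) <=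
  (1 - alpha k * mu) * \int[Pr]_w (enorm (x k w - xs) ^+ 2)
  - 2 * alpha k * \int[Pr]_w (fr (x k w) - fstar) + (alpha k * Mf) ^+ 2
  - q * \int[Pr]_w (dist (v k.+1 w) X ^+ 2).
Proof.
move=> Xxs fxs; have Yxs : Y xs by case: Xxs.
have bx j := bounded_rv_sqdist xs (xY j) (@x_measurable j).
have bv := bounded_rv_sqdist xs (vY k) (@v_measurable k).
have bg := bounded_rv_gap k.
pose r := beta * (2 - beta * LN) / Mg ^+ 2.
have r0 : 0 < r by rewrite /r divr_gt0// exprn_gt0.
(* The sampled violation at [v k.+1 w] is dominated by the scaled decrease of the squared distance
   to [xs], a bounded random variable. Since [q = r / c], [freezing] then returns that decrease with
   coefficient 1. *)
pose H w := r^-1 * (enorm (v k.+1 w - xs) ^+ 2 - enorm (x k.+1 w - xs) ^+ 2).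
have bH : bounded_rv H by apply: bounded_rvZ; exact: bounded_rvB.
have GH w : N%:R^-1 * \sum_(i < N)
    fine ((g (om k.+1 i w))^\+%E (v k.+1 w)) ^+ 2 <= H w.
  rewrite /H -ler_pdivrMl ?invr_gt0// invrK.
  have := feasibility_step hN hproblem hA halg hLN hbeta k w Xxs.
  rewrite -/r; lra.
have hfreeze :=
  freezing hN hproblem hA sfP subgP x0m hc hB (@v_history k) (vY k) bH GH.
rewrite (expectZ Pr _ (bounded_rvB bv (bx k.+1))) in hfreeze.
rewrite (expectB Pr bv (bx k.+1)) in hfreeze.
have {hfreeze} : q * \int[Pr]_w (dist (v k.+1 w) X ^+ 2) <=
    \int[Pr]_w (enorm (v k.+1 w - xs) ^+ 2) -
    \int[Pr]_w (enorm (x k.+1 w - xs) ^+ 2).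
  have := ler_wpM2l (ltW rate_gt0) hfreeze.
  have -> : forall t, q * (c * (r^-1 * t)) = t.
    have [/andP[L0 _] _] := hLN; have /andP[b0 b2] := hbeta.
    have bL : 0 < 2 - beta * LN by rewrite subr_gt0 -ltr_pdivlMr.
    by move=> t; rewrite /q /r; field; rewrite !gt_eqF.
  by [].
have : \int[Pr]_w (enorm (v k.+1 w - xs) ^+ 2) <=
    (1 - alpha k * mu) * \int[Pr]_w (enorm (x k w - xs) ^+ 2)
    - 2 * alpha k * \int[Pr]_w (fr (x k w) - fstar) + (alpha k * Mf) ^+ 2.
  have b1 := bounded_rvZ (1 - alpha k * mu) (bx k).
  have b2 := bounded_rvZ (2 * alpha k) bg.
  have b3 := @bounded_rv_cst R _ Omega ((alpha k * Mf) ^+ 2).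
  have b12 := bounded_rvB b1 b2; have b123 := bounded_rvD b12 b3.
  have h w := gradient_step hproblem hA halg alpha0 k w Yxs.
  have := le_expect Pr bv b123.
  rewrite (expectD Pr b12 b3) (expectB Pr b1 b2) (expectZ Pr _ (bx k)).
  rewrite (expectZ Pr _ bg) expect_cst; apply.
  by move=> w; rewrite -fxs; exact: h.
lra.
Qed.

(** The distance in [f_ge_dist] is moved from [x k] to [v k.+1], where the recursion controls it, at
    the cost of the gradient step length. *)
Lemma gap_ge k : - (Mf * (\int[Pr]_w dist (v k.+1 w) X + alpha k * Mf)) <=
  \int[Pr]_w (fr (x k w) - fstar).
Proof.
have bd := bounded_rv_dist (vY k) (@v_measurable k).
have bc := @bounded_rv_cst R _ Omega (alpha k * Mf).
have bs := bounded_rvD bd bc.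
have := le_expect Pr (bounded_rvZ (- Mf) bs) (bounded_rv_gap k).
rewrite (expectZ Pr _ bs) (expectD Pr bd bc) expect_cst mulNr; apply=> w.
have := f_ge_dist hproblem hA sfP (xY k w).
have : dist (x k w) X <= dist (v k.+1 w) X + alpha k * Mf.
  apply: le_trans (dist_lipschitz X0 _ (v k.+1 w)) _.
  by rewrite lerD2l enormB; exact: (gradient_step_length hproblem hA halg alpha0).
rewrite mulNr -(ler_pM2l Mf0) -/X -/(fr _) -/fstar; lra.
Qed.

Lemma expect_dist_iterate k : \int[Pr]_w dist (x k w) X <=
  \int[Pr]_w dist (v k.+1 w) X + alpha k * Mf.
Proof.
have bd := bounded_rv_dist (vY k) (@v_measurable k).
have bc := @bounded_rv_cst R _ Omega (alpha k * Mf).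
rewrite -[X in _ + X](expect_cst Pr) -(expectD Pr bd bc).
apply: le_expect (bounded_rv_dist (xY k) (@x_measurable k)) (bounded_rvD bd bc) _.
move=> w; apply: le_trans (dist_lipschitz X0 _ (v k.+1 w)) _.
by rewrite lerD2l enormB; exact: (gradient_step_length hproblem hA halg alpha0).
Qed.

(** Integrate [0 <= s * (y - s^-1) ^+ 2] with [y] the distance. *)
Lemma expect_dist_am_gm k s : 0 < s -> 2 * \int[Pr]_w dist (v k.+1 w) X <=
  s * \int[Pr]_w (dist (v k.+1 w) X ^+ 2) + s^-1.
Proof.
move=> s0; have bd := bounded_rv_dist (vY k) (@v_measurable k).
have bd2 := bounded_rvX2 bd; have bc := @bounded_rv_cst R _ Omega s^-1.
rewrite -(expectZ Pr _ bd) -(expectZ Pr _ bd2) -[X in _ + X](expect_cst Pr).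
rewrite -(expectD Pr (bounded_rvZ s bd2) bc).
apply: le_expect (bounded_rvZ 2 bd) (bounded_rvD (bounded_rvZ s bd2) bc) _ => w.
have := mulr_ge0 (ltW s0) (sqr_ge0 (dist (v k.+1 w) X - s^-1)).
set y := dist _ _; have -> : s * (y - s^-1) ^+ 2 = s * y ^+ 2 - 2 * y + s^-1.
  by field; rewrite gt_eqF.
lra.
Qed.

Let p k : R := k.+1%:R ^+ 2.
Let p0 k : 0 < p k. Proof. by rewrite exprn_gt0. Qed.

Lemma weight_sum_gt0 t : (0 < t)%N -> 0 < weight_sum t :> R.
Proof.
move=> t0; apply: lt_le_trans (weight_sum_ge t).
by rewrite divr_gt0// exprn_gt0// ltr0n.
Qed.

Lemma average_in_Y t w : (0 < t)%N -> Y (average x t w).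
Proof.
by move=> t0; apply: (convex_weighted_mean (Y_convex hA) t0 p0) => k _; exact: xY.
Qed.

Lemma dist_average_le t w : (0 < t)%N -> dist (average x t w) X <=
  \sum_(1 <= k < t.+1) p k / weight_sum t * dist (x k w) X.
Proof.
move=> t0.
exact: (dist_weighted_mean X0 (fun k => x k w) (convex_feasible hproblem hA) t0 p0).
Qed.

(** The gap at the average lies between [- Mf] times the mean distance and the mean gap. The factor
    2 is needed because the mean gap may itself be as low as this lower bound. *)
Lemma gap_average_le t w : (0 < t)%N -> `|fr (average x t w) - fstar| <=
  \sum_(1 <= k < t.+1) p k / weight_sum t * (fr (x k w) - fstar) +
  2 * Mf * \sum_(1 <= k < t.+1) p k / weight_sum t * dist (x k w) X.
Proof.
move=> t0; have S0 := weight_sum_gt0 t0.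
have := f_weighted_mean hproblem hA sfP t0 p0 (xY ^~ w).
rewrite -/(average x t w) -/(fr _) => h1.
have h2 := f_ge_dist hproblem hA sfP (average_in_Y w t0).
have h3 := ler_wpM2l (ltW Mf0) (dist_average_le w t0).
have h4 := dist_ge0 X0 (average x t w).
have h5 := ler_wpM2l (ltW Mf0) h4.
have -> : \sum_(1 <= k < t.+1) p k / weight_sum t * (fr (x k w) - fstar) =
    \sum_(1 <= k < t.+1) p k / weight_sum t * fr (x k w) - fstar.
  under eq_bigr do rewrite mulrBr.
  rewrite sumrB -mulr_suml -mulr_suml -/(weight_sum t).
  by rewrite divff ?gt_eqF// mul1r.
move: h1 h2; rewrite -/X -/(fr _) -/fstar => h1 h2.
rewrite ler_norml; apply/andP; split; lra.
Qed.

Lemma average_rates : exists2 C, 0 < C & forall t, (0 < t)%N ->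
  (\int[Pr]_w `|fr (average x t w) - fstar|%:E <= (C / t%:R)%:E)%E /\
  (\int[Pr]_w (dist (average x t w) X)%:E <= (C / t%:R)%:E)%E.
Proof.
have [xs [Xxs fxs]] := optimal_nonempty hA.
have fE : fr xs = fstar by rewrite /fr fxs.
have sq0 (h : Omega -> R) : 0 <= \int[Pr]_w (h w ^+ 2).
  by apply: Rintegral_ge0 => w _; exact: sqr_ge0.
have [||C C0 hC] := @weighted_bounds R
  (fun k => \int[Pr]_w (enorm (x k w - xs) ^+ 2))
  (fun k => \int[Pr]_w (fr (x k w) - fstar))
  (fun k => \int[Pr]_w (dist (v k.+1 w) X ^+ 2))
  (fun k => \int[Pr]_w dist (v k.+1 w) X) mu Mf q mu0 Mf0 rate_gt0
  (fun k => sq0 _) (fun k => sq0 _) _ _ expect_dist_am_gm.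
- by move=> k; rewrite -halpha; exact: iteration_step.
- by move=> k; rewrite -halpha; exact: gap_ge.
have C'0 : 0 < 3 * C * (1 + 2 * Mf) by rewrite !mulr_gt0// addr_gt0// mulr_gt0.
exists (3 * C * (1 + 2 * Mf)) => // t t0; have S0 := weight_sum_gt0 t0.
have t1 : 0 < t%:R :> R by rewrite ltr0n.
have [hgap hdist] := hC t t0.
(* This is where the bound of order [t ^+ 2] meets [weight_sum t >= t ^+ 3 / 3]. *)
have rate z : z <= C * t%:R ^+ 2 -> z / weight_sum t <= 3 * C / t%:R.
  move=> hz; rewrite ler_pdivrMr//; apply: le_trans hz _.
  have := ler_wpM2l (ltW (divr_gt0 (mulr_gt0 (ltr0n R 3) C0) t1)) (weight_sum_ge t).
  by congr (_ <= _); field; rewrite gt_eqF.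
have bd k := bounded_rvZ (p k / weight_sum t)
  (bounded_rv_dist (xY k) (@x_measurable k)).
have bg k := bounded_rvZ (p k / weight_sum t) (bounded_rv_gap k).
pose DS w := \sum_(1 <= k < t.+1) p k / weight_sum t * dist (x k w) X.
pose GS w := \sum_(1 <= k < t.+1) p k / weight_sum t * (fr (x k w) - fstar).
have bDS : bounded_rv DS by exact: bounded_rv_sum.
have bGS : bounded_rv GS by exact: bounded_rv_sum.
have eD : \int[Pr]_w DS w <= 3 * C / t%:R.
  rewrite expect_sum//; apply: le_trans (rate _ hdist).
  rewrite mulr_suml; apply: ler_sum => k _.
  rewrite expectZ; last exact: bounded_rv_dist.
  rewrite mulrAC ler_wpM2r ?invr_ge0 ?(ltW S0)// ler_wpM2l ?(ltW (p0 k))//.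
  by rewrite -halpha; exact: expect_dist_iterate.
have eG : \int[Pr]_w GS w <= 3 * C / t%:R.
  rewrite expect_sum//; apply: le_trans (rate _ hgap).
  rewrite mulr_suml; apply: ler_sum => k _.
  by rewrite expectZ 1?mulrAC//; exact: bounded_rv_gap.
have Ct0 : 0 <= 3 * C / t%:R by rewrite divr_ge0 ?mulr_ge0 ?ltW.
split.
  apply: (@le_trans _ _ (\int[Pr]_w (GS w + 2 * Mf * DS w)%:E)%E).
    apply: ge0_le_integral_nonmeasurable => w; rewrite lee_fin//.
    exact: gap_average_le.
  rewrite bounded_rv_integralE; last by apply: bounded_rvD => //; exact: bounded_rvZ.
  rewrite lee_fin expectD//; last exact: bounded_rvZ.
  rewrite expectZ//.
  have := ler_wpM2l (ltW (mulr_gt0 (ltr0n R 2) Mf0)) eD; lra.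
apply: (@le_trans _ _ (\int[Pr]_w (DS w)%:E)%E).
  apply: ge0_le_integral_nonmeasurable => w; rewrite lee_fin ?dist_ge0//.
  exact: dist_average_le.
rewrite bounded_rv_integralE// lee_fin; apply: le_trans eD _.
have := mulr_ge0 (ltW Mf0) Ct0; lra.
Qed.

End Rate.

Theorem theorem2 (R : realType) (n N : nat)
  (dA : measure_display) (A : measurableType dA) (PA : probability A R)
  (dO : measure_display) (Omega : measurableType dO) (Pr : probability Omega R)
  (f : 'rV[R]_n -> \bar R) (g : A -> 'rV[R]_n -> \bar R) (Y : set 'rV[R]_n)
  (mu Mf Mg c beta LN : R) (alpha : nat -> R)
  (sf : 'rV[R]_n -> 'rV[R]_n) (om : nat -> 'I_N -> {RV Pr >-> A})
  (x v : nat -> Omega -> 'rV[R]_n) (d : nat -> 'I_N -> Omega -> 'rV[R]_n)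
  (hN : (1 <= N)%N)
  (hproblem : convex_problem f g Y)
  (hA : assumption_A f g Y mu Mf Mg)
  (halg : parallel_algorithm f g Y om x v d PA alpha beta sf)
  (hc : 0 < c)
  (hB : assumption_B g Y om x c)
  (halpha : forall k, alpha k = 4 / (mu * k.+1%:R))
  (hLN : is_minibatch_constant g om v d LN)
  (hbeta : 0 < beta < 2 / LN)
  (hcond : 1 < c * Mg ^+ 2 * LN) :
  let q : R := beta * (2 - beta * LN) / (c * Mg ^+ 2) in
  let b : R := (1 - q)^-1 - 1 in
  [/\ q < 1,
      le_bigO
        (fun t => \int[Pr]_w `|f (average x t w) - optimal_value f g Y|)%E
        (fun t => 1 / t%:R + 1 / (Num.sqrt b * t%:R)) &
      le_bigO
        (fun t => 'E_Pr[fun w => dist (average x t w) (feasible g Y)])%E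
        (fun t => 1 / (Num.sqrt b * t%:R))].
Proof.
move=> q b.
have q0 : 0 < q := rate_gt0 hA hc hLN hbeta.
have q1 : q < 1 := rate_lt1 beta hA hc hLN hcond.
have b0 : 0 < Num.sqrt b.
  by rewrite sqrtr_gt0 subr_gt0 invf_gt1 ?subr_gt0// gtrBl.
have [C C0 hC] := average_rates hN hproblem hA halg hc hB halpha hLN hbeta.
split => //.
  (* Starting at [t = 1] excludes the empty average, which is 0 and may lie outside [Y], where [f]
     need not be finite. *)
  exists C, 1%N; split => // t t0; have t1 : 0 < t%:R :> R by rewrite ltr0n.
  rewrite (_ : \int[Pr]_w `|f (average x t w) - optimal_value f g Y| =
    \int[Pr]_w `|fine (f (average x t w)) -
      fine (optimal_value f g Y)|%:E)%E; last first.
    apply: eq_integral => w _; rewrite [in LHS](optimal_valueE hproblem).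
    rewrite [in LHS](f_fin hproblem hA (sf_subgradient halg)) -?EFinB//.
    exact: (average_in_Y hproblem hA halg).
  apply: le_trans (hC t t0).1 _; rewrite lee_fin ler_wpM2l ?(ltW C0)//.
  by rewrite div1r lerDl divr_ge0// ltW// mulr_gt0.
(* Since [b] does not depend on [t], the constant may contain [Num.sqrt b], which cancels the one in
   the rate. *)
exists (C * Num.sqrt b), 1%N; split; first exact: mulr_gt0.
move=> t t0; have t1 : 0 < t%:R :> R by rewrite ltr0n.
rewrite unlock; apply: le_trans (hC t t0).2 _; rewrite lee_fin le_eqVlt.
by apply/orP; left; apply/eqP; field; rewrite !gt_eqF.
Qed.
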